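(* Let $G_A$ be an almost abelian Lie group, of even dimension $2n$, with Lie algebra $\mathfrak g_A=\mathbb Re_0\ltimes_A\mathfrak h$, where $A$ is a real diagonal matrix. If $G_A$ admits a left-invariant generalized complex structure of type $k$, then $G_A$ also admits a left-invariant generalized complex structure of type $k+1$ or of type $k-1$.
   Context: Almost abelian Lie groups: $\mathfrak g_A=\mathbb Re_0\ltimes_A\mathfrak h$ is the real Lie algebra with abelian ideal $\mathfrak h\cong\mathbb R^{2n-1}$ of codimension one and bracket $[e_0,v]=Av$ for $v\in\mathfrak h$, where $A$ is the matrix of $\mathrm{ad}_{e_0}|_{\mathfrak h}$ in a fixed basis of $\mathfrak h$; $G_A$ is the simply connected Lie group with Lie algebra $\mathfrak g_A$. Left-invariant generalized complex structures: for a Lie group $G$ with Lie algebra $\mathfrak g$ of real dimension $2n$, give $\mathfrak g\oplus\mathfrak g^*$ the pairing $\langle X+\xi,Y+\eta\rangle=\frac12(\xi(Y)+\eta(X))$. A left-invariant generalized complex structure on $G$ is (equivalently) a linear map $\mathcal J$ of $\mathfrak g\oplus\mathfrak g^*$ with $\mathcal J^2=-\mathrm{Id}$, orthogonal for the pairing, whose $\mathbf i$-eigenspace $L\subset(\mathfrak g\oplus\mathfrak g^* )\otimes\mathbb C$ is closed under the Courant bracket on left-invariant sections, $[[X+\xi,Y+\eta]]=[X,Y]+\mathrm{ad}^*_X\eta-\mathrm{ad}^*_Y\xi$, with $(\mathrm{ad}^*_X\eta)(Y)=-\eta([X,Y])$ (extended $\mathbb C$-bilinearly). The space $L$ is the annihilator,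 for the Clifford action $(X+\xi)\cdot\rho=\iota_X\rho+\xi\wedge\rho$, of a unique complex line $K_L\subset\bigwedge^\bullet\mathfrak g^*\otimes\mathbb C$. Any generator $\rho$ of $K_L$ has the form $\rho=\exp(B+\mathbf i\omega)\wedge\Omega$ with $B,\omega\in\bigwedge^2\mathfrak g^*$ real and $\Omega=\theta_1\wedge\cdots\wedge\theta_k$ with linearly independent $\theta_i\in\mathfrak g^*\otimes\mathbb C$ ($\Omega$ a nonzero constant if $k=0$), and satisfies $\omega^{n-k}\wedge\Omega\wedge\overline\Omega\ne0$. The integer $k\in\{0,\dots,n\}$ is the type of $\mathcal J$. *)

(* Defs.v *)
From HB Require Import structures.
From mathcomp Require Import all_boot all_order all_algebra.
From mathcomp Require Import complex.
From mathcomp Require Import reals.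

Set Implicit Arguments.
Unset Strict Implicit.
Unset Printing Implicit Defensive.

Import Order.TTheory GRing.Theory Num.Theory.
Local Open Scope ring_scope.

(* Throughout, g is given in coordinates: vectors are row vectors in a fixed   *)
(* basis of g, covectors are row vectors in the dual basis, and X + xi in      *)
(* g (+) g^* is row_mx X xi. A linear map of matrix J acts by u |-> u *m J.    *)

Section ExteriorAlgebra.
Variables (K : fieldType) (N : nat).

(* The coefficient at S = {s_1 < ... < s_p} is that of e^{s_1} /\ ... /\ e^{s_p}, *)
(* where (e^i) is the dual basis. *)
Definition form := {ffun {set 'I_N} -> K^o}.

Definition homogeneous (p : nat) (a : form) : Prop :=
  forall S : {set 'I_N}, #|S| != p -> a S = 0.

Definition form1 : form := [ffun S => (S == set0)%:R].

Definition covector_form (xi : 'rV[K]_N) : form :=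
  [ffun S => \sum_(i | S == [set i]) xi 0 i].

(* e^S /\ e^T = (-1) ^ (inversions S T) e^(S :|: T) for disjoint S and T *)
Definition inversions (S T : {set 'I_N}) : nat :=
  #|[set p in setX S T | (p.2 < p.1)%N]|.

Definition wedge (a b : form) : form :=
  [ffun S : {set 'I_N} => \sum_(T : {set 'I_N} | T \subset S)
     (-1) ^+ inversions T (S :\: T) * (a T * b (S :\: T))].

Definition wedge_pow (a : form) (j : nat) : form := iter j (wedge a) form1.

(* The terms with 2j > N vanish on 2-forms, so this is the full exponential. *)
Definition wedge_exp (a : form) : form :=
  \sum_(j < N.+1) (j`!%:R)^-1 *: wedge_pow a j.

Definition wedge_rows (k : nat) (theta : 'M[K]_(k, N)) : form :=
  \big[wedge/form1]_(i < k) covector_form (row i theta).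

(* iota_{e_i} (e^i /\ e^S) = e^S for i not in S *)
Definition contract (X : 'rV[K]_N) (a : form) : form :=
  [ffun S : {set 'I_N} => \sum_(i | i \notin S)
     (-1) ^+ inversions [set i] S * (X 0 i * a (i |: S))].

Definition clifford (u : 'rV[K]_(N + N)) (a : form) : form :=
  contract (lsubmx u) a + wedge (covector_form (rsubmx u)) a.

End ExteriorAlgebra.

Section GeneralizedTangent.
Variables (K : fieldType) (N : nat).

Definition eval_covector (xi X : 'rV[K]_N) : K := \sum_i xi 0 i * X 0 i.

Definition pairing (u v : 'rV[K]_(N + N)) : K :=
  2%:R^-1 * (eval_covector (rsubmx u) (lsubmx v) +
             eval_covector (rsubmx v) (lsubmx u)).

Variable br : 'rV[K]_N -> 'rV[K]_N -> 'rV[K]_N.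

(* (ad^*_X eta) (Y) = - eta [X, Y] *)
Definition coad (X eta : 'rV[K]_N) : 'rV[K]_N :=
  \row_j - eval_covector eta (br X (delta_mx 0 j)).

Definition courant (u v : 'rV[K]_(N + N)) : 'rV[K]_(N + N) :=
  row_mx (br (lsubmx u) (lsubmx v))
         (coad (lsubmx u) (rsubmx v) - coad (lsubmx v) (rsubmx u)).

End GeneralizedTangent.

(* The bracket of K e_0 |x_A K^m: [x_0 e_0 + v, y_0 e_0 + w] = x_0 A w - y_0 A v, *)
(* with coordinate 0 along e_0; A acts on column vectors, hence the transpose. *)
Definition almost_abelian_bracket (K : fieldType) (m : nat) (A : 'M[K]_m)
    (x y : 'rV[K]_(1 + m)) : 'rV[K]_(1 + m) :=
  row_mx 0 ((x 0 0) *: (rsubmx y *m A^T) - (y 0 0) *: (rsubmx x *m A^T)).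

Section GeneralizedComplex.
Variables (R : realType) (N : nat).

Definition complexify_mx (p q : nat) (M : 'M[R]_(p, q)) : 'M[R[i]]_(p, q) :=
  map_mx (real_complex R) M.

Definition complex_form (B omega : form R N) : form R[i] N :=
  [ffun S => (Complex (B S) (omega S) : R[i])].

Definition conj_form (a : form R[i] N) : form R[i] N :=
  [ffun S => conjc (a S)].

Definition i_eigenspace (J : 'M[R]_(N + N)) (u : 'rV[R[i]]_(N + N)) : Prop :=
  u *m complexify_mx J = (Complex 0 1 : R[i]) *: u.

(* brC is the C-bilinear extension to g (x) C of the bracket of g. *)
Definition generalized_complex
    (brC : 'rV[R[i]]_N -> 'rV[R[i]]_N -> 'rV[R[i]]_N)
    (J : 'M[R]_(N + N)) : Prop :=
  [/\ J *m J = - 1%:M,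
      forall u v : 'rV[R]_(N + N), pairing (u *m J) (v *m J) = pairing u v &
      forall u v : 'rV[R[i]]_(N + N), i_eigenspace J u -> i_eigenspace J v ->
        i_eigenspace J (courant brC u v)].

(* The annihilator of rho is the i-eigenspace of J: rho is a pure spinor for J. *)
Definition spinor_generator (J : 'M[R]_(N + N)) (rho : form R[i] N) : Prop :=
  rho != 0 /\
  forall u : 'rV[R[i]]_(N + N), i_eigenspace J u <-> clifford u rho = 0.

(* rho = exp (B + i omega) /\ Omega with Omega = c theta_1 /\ ... /\ theta_k;  *)
(* the scalar c only matters for k = 0, where it is the nonzero constant Omega. *)
Definition has_type (n : nat) (J : 'M[R]_(N + N)) (k : nat) : Prop :=
  (k <= n)%N /\
  exists (B omega : form R N) (c : R[i]) (theta : 'M[R[i]]_(k, N)),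
    let Omega : form R[i] N := c *: wedge_rows theta in
    [/\ homogeneous 2 B, homogeneous 2 omega, c != 0, row_free theta &
    spinor_generator J (wedge (wedge_exp (complex_form B omega)) Omega) /\
    wedge (wedge (wedge_pow (complex_form omega 0) (n - k)) Omega)
          (conj_form Omega) != 0].

End GeneralizedComplex.

Definition admits_gcs_of_type (R : realType) (n m : nat) (A : 'M[R]_m)
    (k : nat) : Prop :=
  exists J : 'M[R]_((1 + m) + (1 + m)),
    generalized_complex (almost_abelian_bracket (complexify_mx A)) J /\
    has_type n J k.

(* Main.v *)
From HB Require Import structures.
Require Import Defs.
From mathcomp Require Import all_boot all_order all_algebra.
From mathcomp Require Import complex.
From mathcomp Require Import reals.
From mathcomp Require Import ring.

(** Let T = g + g^*, with its pairing, let E = e^0 and let D be ad e_0 acting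
on T. The operator D is skew and diagonal, with opposite weights on dual basis
vectors, and the Courant bracket is
  [u, v] = 2<u,E> D v - 2<v,E> D u + 2<D u,v> E         ([courant_diag]).

Given a structure J, put f = J E - c E, where c is the coefficient of J E on E.
Closure of the i-eigenspace L, applied to E - i J E and to a vector of L not
orthogonal to E, forces D f = lam f for a real lam ([f_eigen]). As D is
diagonal, some basis vector w satisfies D w = - lam w and <f,w> <> 0. Let tau be
the reflection of T in the vector r = f - w; it exchanges f and w. Then
J' = tau J tau is again a generalized complex structure: conjugating D by tau
only alters it on the plane spanned by f and w, and since <f,u> is a multiple of
<E,u> on L, the resulting change of the bracket of two elements of L is a
multiple of E - i J E, which lies in L
([metric_bracket_reflection], [exists_reflection]).

A reflection changes the type by exactly one. This is read off the pure spinor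
rho = exp(b) Om of J, with b a complex 2-form: by the Clifford relations r.rho
is a pure spinor of J' ([clif_reflection]). Write r = X + xi, let iota_X be the
contraction by X, and put eta = xi + iota_X b. Then r.rho = exp(b) (eta Om + iota_X Om) ([clif_exp]), and
there are two cases.
- If iota_X Om = 0, then r.rho = exp(b) (eta Om) has type k + 1
  ([type_increase]).
- Otherwise Om = th Om' with th(X) = 1 and iota_X Om' = 0
  ([decomposable_split]), so that r.rho = exp(b) (1 + eta th) Om' =
  exp(b + eta th) Om' has type k - 1 ([type_decrease]).
In both cases nondegeneracy follows from that of rho by contracting the top
form with X. In terms of del = b - conj b = 2 i omega,
  eta iota_X(del^p Om conj Om) = <r,r> del^p Om conj Om
in the first case, while in the second the new 2-form del' satisfies
iota_X del' = <r,r> (th - conj th). *)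

Set Implicit Arguments.
Unset Strict Implicit.
Unset Printing Implicit Defensive.

Import Order.TTheory GRing.Theory Num.Theory.
Local Open Scope ring_scope.

(** * Signs and subsets *)

Section Inversions.
Variable N : nat.
Implicit Types S T U : {set 'I_N}.

Lemma inversionsE S T :
  inversions S T = (\sum_(i in S) \sum_(j in T) (j < i)%N)%N.
Proof.
rewrite /inversions pair_big_dep /= -sum1_card.
under eq_bigl do rewrite !inE.
rewrite big_mkcondr; apply: eq_bigr => p _.
by case: ltnP.
Qed.

Lemma sum_setU S T (F : 'I_N -> nat) : [disjoint S & T] ->
  (\sum_(i in S :|: T) F i = \sum_(i in S) F i + \sum_(i in T) F i)%N.
Proof.
by move=> dST; rewrite -bigU //; apply: eq_bigl => i; rewrite !inE.
Qed.

Lemma inversionsUl S T U : [disjoint S & T] ->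
  inversions (S :|: T) U = (inversions S U + inversions T U)%N.
Proof. by move=> dST; rewrite !inversionsE sum_setU. Qed.

Lemma inversionsUr S T U : [disjoint T & U] ->
  inversions S (T :|: U) = (inversions S T + inversions S U)%N.
Proof.
move=> dTU; rewrite !inversionsE -big_split; apply: eq_bigr => i _.
by rewrite sum_setU.
Qed.

Lemma inversionsC S T : [disjoint S & T] ->
  (inversions S T + inversions T S = #|S| * #|T|)%N.
Proof.
move=> dST; rewrite !inversionsE [X in (_ + X)%N]exchange_big -big_split /=.
rewrite -sum_nat_const; apply: eq_bigr => i Si.
rewrite -big_split -sum1_card /=; apply: eq_bigr => j Tj.
have: i != j by apply: contraTneq Tj => <-; rewrite (disjointFr dST).
by rewrite -val_eqE /=; case: ltngtP.
Qed.

Lemma inversions0l S : inversions set0 S = 0%N.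
Proof. by rewrite inversionsE big_set0. Qed.

Lemma inversions0r S : inversions S set0 = 0%N.
Proof. by rewrite inversionsE big1 // => i _; rewrite big_set0. Qed.

End Inversions.

Section SetDifference.
Variable T : finType.
Implicit Types A B : {set T}.

Lemma disjoint_setD A B : [disjoint A :\: B & B].
Proof. by rewrite -setI_eq0 setIDAC -setIDA setDv setI0. Qed.

Lemma setU_setD A B : B \subset A -> B :|: (A :\: B) = A.
Proof. by move=> sBA; rewrite setDE setUIr setUCr setIT; apply/setUidPr. Qed.

Lemma setD_setU A B : [disjoint A & B] -> (B :|: A) :\: B = A.
Proof. by move=> dAB; rewrite setDUl setDv set0U; apply/setDidPl. Qed.

Lemma card_setU_setD A B : B \subset A -> #|A| = (#|B| + #|A :\: B|)%N.
Proof. by move=> sBA; rewrite -(cardsID B A) (setIidPr sBA). Qed.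

End SetDifference.

(** * The exterior algebra *)

Section ExteriorRing.
Variables (K : fieldType) (N : nat).

(** A separate name for the space of forms: functions into a ring already carry
the coefficientwise product, while here the product is the wedge. *)
Definition ext := Defs.form K N.
HB.instance Definition _ := GRing.Lmodule.copy ext (Defs.form K N).

Implicit Types (a b c : ext) (S T U : {set 'I_N}) (X xi : 'rV[K]_N).

(** Reads a coefficient in [K] rather than in the regular module [K^o]. *)
Definition coef a S : K := a S.

Lemma extP a b : (forall S, coef a S = coef b S) -> a = b.
Proof. by move=> eq_ab; apply/ffunP. Qed.

Lemma coefD a b S : coef (a + b) S = coef a S + coef b S.
Proof. by rewrite /coef ffunE. Qed.

Lemma coefN a S : coef (- a) S = - coef a S.
Proof. by rewrite /coef ffunE. Qed.

Lemma coef0 S : coef 0 S = 0.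
Proof. by rewrite /coef ffunE. Qed.

Lemma coefZ x a S : coef (x *: a) S = x * coef a S.
Proof. by rewrite /coef ffunE. Qed.

Definition wedge_ext : ext -> ext -> ext := @wedge K N.

Lemma coef_wedge a b S : coef (wedge_ext a b) S =
  \sum_(T : {set 'I_N} | T \subset S)
     (-1) ^+ inversions T (S :\: T) * (coef a T * coef b (S :\: T)).
Proof. by rewrite /coef ffunE. Qed.

Lemma coef_form1 S : coef (form1 K N) S = (S == set0)%:R.
Proof. by rewrite /coef ffunE. Qed.

Lemma big_subset_union (V : nmodType) S T (F : {set 'I_N} -> V) :
  [disjoint S & T] ->
  \sum_(U : {set 'I_N} | (T \subset U) && (U \subset T :|: S)) F U =
  \sum_(U : {set 'I_N} | U \subset S) F (T :|: U).
Proof.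
move=> dST.
rewrite (reindex_onto (fun U => T :|: U) (fun U => U :\: T)) /=; last first.
  by move=> U /andP[sTU _]; rewrite setU_setD.
apply: eq_bigl => U; apply/andP/idP => [[/andP[_ sUS] /eqP eqU]|sUS].
  have dU : [disjoint U & T] by rewrite -eqU disjoint_setD.
  apply/subsetP=> i Ui; have := subsetP sUS i; rewrite !inE Ui orbT.
  by move/(_ isT); rewrite (disjointFr dU Ui).
rewrite subsetUl setUS //; split=> //.
by apply/eqP/setD_setU; apply: disjointWl dST.
Qed.

(** Both bracketings sum over the ways to split S into three disjoint parts
U, V, W, and inversions are additive in each argument, so the signs agree. *)
Lemma wedgeA : associative wedge_ext.
Proof.
move=> a b c; apply/extP=> S; rewrite !coef_wedge.
under eq_bigr => U sUS do rewrite coef_wedge mulr_sumr mulr_sumr.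
under [RHS]eq_bigr => T sTS do rewrite coef_wedge mulr_suml mulr_sumr.
rewrite [RHS](exchange_big_dep (fun U => U \subset S)) /=; last first.
  by move=> T U sTS sUT; apply: subset_trans sTS.
apply: eq_bigr => U sUS.
have dU := disjoint_setD S U.
transitivity (\sum_(T : {set 'I_N} | (U \subset T) && (T \subset U :|: (S :\: U)))
   (-1) ^+ inversions T (S :\: T) * ((-1) ^+ inversions U (T :\: U) *
     (coef a U * coef b (T :\: U)) * coef c (S :\: T))); last first.
  by apply: eq_bigl => T; rewrite andbC setU_setD.
rewrite big_subset_union //; apply: eq_bigr => V sV.
have dVU : [disjoint V & U] by apply: disjointWl dU.
rewrite setD_setU // -setDDl.
set W := S :\: U :\: V.
have dVW : [disjoint V & W] by rewrite disjoint_sym disjoint_setD.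
rewrite -{1}(setU_setD sV) -/W inversionsUr // inversionsUl 1?disjoint_sym //.
rewrite !exprD; ring.
Qed.

Lemma wedge1l : left_id (form1 K N : ext) wedge_ext.
Proof.
move=> a; apply/extP=> S; rewrite coef_wedge (bigD1 set0) ?sub0set //= big1.
  by rewrite inversions0l coef_form1 eqxx setD0 !mul1r addr0.
by move=> T /andP[_ /negPf nT]; rewrite coef_form1 nT mul0r mulr0.
Qed.

Lemma wedge1r : right_id (form1 K N : ext) wedge_ext.
Proof.
move=> a; apply/extP=> S; rewrite coef_wedge (bigD1 S) //= big1.
  by rewrite setDv inversions0r coef_form1 eqxx mulr1 mul1r addr0.
move=> T /andP[sTS nT]; rewrite coef_form1 setD_eq0.
case: (boolP (S \subset T)) => [sST|_]; last by rewrite !mulr0.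
by case/eqP: nT; apply/eqP; rewrite eqEsubset sTS.
Qed.

Lemma wedgeDl : left_distributive wedge_ext +%R.
Proof.
move=> a b c; apply/extP=> S; rewrite [RHS]coefD !coef_wedge -big_split /=.
by apply: eq_bigr => T _; rewrite coefD; ring.
Qed.

Lemma wedgeDr : right_distributive wedge_ext +%R.
Proof.
move=> a b c; apply/extP=> S; rewrite [RHS]coefD !coef_wedge -big_split /=.
by apply: eq_bigr => T _; rewrite coefD; ring.
Qed.

Lemma form1_neq0 : (form1 K N : ext) != 0.
Proof.
apply/eqP=> /(congr1 (coef^~ set0)) /eqP.
by rewrite coef_form1 coef0 eqxx oner_eq0.
Qed.

HB.instance Definition _ := GRing.Zmodule_isNzRing.Build ext
  wedgeA wedge1l wedge1r wedgeDl wedgeDr form1_neq0.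

Lemma scale_wedgel (x : K) a b : x *: (a * b) = x *: a * b.
Proof.
apply/extP=> S; rewrite coefZ !coef_wedge mulr_sumr.
by apply: eq_bigr => T _; rewrite coefZ; ring.
Qed.

HB.instance Definition _ := GRing.Lmodule_isLalgebra.Build K ext scale_wedgel.

Lemma scale_wedger (x : K) a b : x *: (a * b) = a * (x *: b).
Proof.
apply/extP=> S; rewrite coefZ !coef_wedge mulr_sumr.
by apply: eq_bigr => T _; rewrite coefZ; ring.
Qed.

HB.instance Definition _ := GRing.Lalgebra_isAlgebra.Build K ext scale_wedger.

End ExteriorRing.

(** * Grading and interior product *)

Section Contraction.
Variables (K : fieldType) (N : nat).
Local Notation ext := (ext K N).
Implicit Types (a b c : ext) (S T U : {set 'I_N}) (X xi : 'rV[K]_N).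

Lemma coefM a b S : coef (a * b) S =
  \sum_(T : {set 'I_N} | T \subset S)
     (-1) ^+ inversions T (S :\: T) * (coef a T * coef b (S :\: T)).
Proof. exact: coef_wedge. Qed.

Lemma coef1 S : coef (1 : ext) S = (S == set0)%:R.
Proof. exact: coef_form1. Qed.

(** The grading involution, by which odd derivations pass elements. *)
Definition grinv a : ext := [ffun S : {set 'I_N} => (-1) ^+ #|S| * a S].

Lemma coef_grinv a S : coef (grinv a) S = (-1) ^+ #|S| * coef a S.
Proof. by rewrite /coef ffunE. Qed.

Lemma coef_iter_grinv p a S :
  coef (iter p grinv a) S = (-1) ^+ (p * #|S|) * coef a S.
Proof.
elim: p => [|p IHp]; first by rewrite mul0n mul1r.
by rewrite iterS coef_grinv IHp mulSn exprD mulrA.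
Qed.

Lemma grinv_is_additive : additive grinv.
Proof.
by move=> a b; apply/extP=> S; rewrite !(coef_grinv, coefD, coefN); ring.
Qed.

Lemma grinv_is_multiplicative : multiplicative grinv.
Proof.
split=> [a b|]; apply/extP=> S.
  rewrite coef_grinv !coefM mulr_sumr; apply: eq_bigr => T sTS.
  by rewrite !coef_grinv (card_setU_setD sTS) exprD; ring.
rewrite coef_grinv coef1; case: eqP => [->|]; last by rewrite mulr0.
by rewrite cards0 mul1r.
Qed.

HB.instance Definition _ := GRing.isAdditive.Build ext ext grinv grinv_is_additive.
HB.instance Definition _ :=
  GRing.isMultiplicative.Build ext ext grinv grinv_is_multiplicative.

Lemma homogeneousM p q a b :
  homogeneous p a -> homogeneous q b -> homogeneous (p + q) (a * b).
Proof.
move=> ha hb S nS; rewrite -/(coef _ S) coefM big1 // => T sTS.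
have [cT|nT] := eqVneq #|T| p; last by rewrite [coef a T]ha // mul0r mulr0.
have [cST|nST] := eqVneq #|S :\: T| q; last by rewrite [coef b _]hb // !mulr0.
by case/eqP: nS; rewrite (card_setU_setD sTS) cT cST.
Qed.

Lemma homogeneous1 : homogeneous 0 (1 : ext).
Proof.
by move=> S; rewrite cards_eq0 -/(coef _ S) coef1 => /negPf ->.
Qed.

Lemma homogeneousX p a j : homogeneous p a -> homogeneous (p * j) (a ^+ j).
Proof.
move=> ha; elim: j => [|j IHj]; first by rewrite muln0; apply: homogeneous1.
by rewrite exprS mulnS; apply: homogeneousM.
Qed.

Lemma homogeneousD p a b :
  homogeneous p a -> homogeneous p b -> homogeneous p (a + b).
Proof.
by move=> ha hb S nS; rewrite -/(coef _ S) coefD [coef a S]ha // [coef b S]hb ?addr0.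
Qed.

Lemma homogeneousZ p x a : homogeneous p a -> homogeneous p (x *: a).
Proof.
by move=> ha S nS; rewrite -/(coef _ S) coefZ [coef a S]ha // mulr0.
Qed.

Lemma homogeneousB p a b :
  homogeneous p a -> homogeneous p b -> homogeneous p (a - b).
Proof.
move=> ha hb; rewrite -scaleN1r.
by apply: homogeneousD ha _; apply: homogeneousZ.
Qed.

Lemma homogeneous_gt p a : (N < p)%N -> homogeneous p a -> a = 0.
Proof.
move=> ltNp ha; apply/extP=> S; rewrite coef0 [coef a S]ha // neq_ltn.
by rewrite (leq_ltn_trans (max_card _)) ?card_ord.
Qed.

Lemma homogeneous_grinv p a : homogeneous p a -> grinv a = (-1) ^+ p *: a.
Proof.
move=> ha; apply/extP=> S; rewrite coef_grinv coefZ.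
have [->//|nS] := eqVneq #|S| p.
by rewrite [coef a S]ha ?mulr0.
Qed.

(** Graded commutativity in one homogeneous argument: swapping disjoint S and T
costs the sign (-1)^(|S||T|), hence the grading involution applied p times. *)
Lemma homogeneousC p a b : homogeneous p a -> a * b = iter p grinv b * a.
Proof.
move=> ha; apply/extP=> S; rewrite !coefM.
rewrite (reindex_onto (fun T => S :\: T) (fun T => S :\: T)) /=; last first.
  by move=> T sTS; rewrite setDDr setDv set0U; apply/setIidPr.
apply: eq_big => [T|T /andP[_ /eqP eT]].
  rewrite subsetDl /= setDDr setDv set0U; apply/eqP/idP => [<-|/setIidPr //].
  exact: subsetIl.
rewrite eT coef_iter_grinv.
have [cS|nS] := eqVneq #|S :\: T| p; last first.
  by rewrite [coef a _]ha // mul0r !mulr0.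
have := @inversionsC _ (S :\: T) T (disjoint_setD _ _).
move/(congr1 (fun n => (-1) ^+ n : K)); rewrite cS exprD => <-.
set e1 := _ ^+ inversions (S :\: T) T; set e2 := _ ^+ inversions T _.
have e22 : e2 * e2 = 1 :> K by rewrite -expr2 sqrr_sign.
by rewrite -[LHS]mul1r -e22; ring.
Qed.

Lemma homogeneous2C a b : homogeneous 2 a -> a * b = b * a.
Proof.
move=> /homogeneousC ->; congr (_ * _); apply/extP=> S.
by rewrite coef_iter_grinv exprM sqrrN expr1n expr1n mul1r.
Qed.

Lemma homogeneous2_grinv a : homogeneous 2 a -> grinv a = a.
Proof. by move/homogeneous_grinv->; rewrite sqrrN expr1n scale1r. Qed.

Definition cov xi : ext := covector_form xi.

Lemma coef_cov xi S : coef (cov xi) S = \sum_(i | S == [set i]) xi 0 i.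
Proof. by rewrite /coef ffunE. Qed.

Lemma coef_cov1 xi i : coef (cov xi) [set i] = xi 0 i.
Proof.
rewrite coef_cov (big_pred1 i) // => j; rewrite /= eq_sym.
by apply/eqP/eqP => [/set1_inj|->].
Qed.

Lemma homogeneous_cov xi : homogeneous 1 (cov xi).
Proof.
move=> S nS; rewrite -/(coef _ S) coef_cov big1 // => i /eqP eS.
by rewrite eS cards1 in nS.
Qed.

Lemma homogeneous1_cov a : homogeneous 1 a -> exists xi, a = cov xi.
Proof.
move=> ha; exists (\row_i coef a [set i]); apply/extP=> S.
have [/cards1P[i ->]|nS] := boolP (#|S| == 1)%N; first by rewrite coef_cov1 mxE.
by rewrite [coef a S]ha // [coef _ S]homogeneous_cov.
Qed.

Lemma cov_is_linear : linear cov.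
Proof.
move=> x xi eta; apply/extP=> S; rewrite coefD coefZ !coef_cov mulr_sumr.
by rewrite -big_split; apply: eq_bigr => i _; rewrite !mxE.
Qed.

HB.instance Definition _ :=
  GRing.isLinear.Build K 'rV[K]_N ext *:%R cov cov_is_linear.

Lemma covC xi a : cov xi * a = grinv a * cov xi.
Proof. exact: homogeneousC (homogeneous_cov xi). Qed.

Definition interior X a : ext := contract X a.

(** The coefficient at S of the contraction by the basis vector e_i. *)
Definition interior_coef i a S : K :=
  if i \in S then 0 else (-1) ^+ inversions [set i] S * coef a (i |: S).

Lemma coef_interior X a S : coef (interior X a) S = \sum_i X 0 i * interior_coef i a S.
Proof.
rewrite /coef ffunE big_mkcond; apply: eq_bigr => i _.
by rewrite /interior_coef; case: (i \in S) => /=; [rewrite mulr0 | exact: (@mulrCA K)].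
Qed.

Lemma interior_is_linear X : linear (interior X).
Proof.
move=> x a b; apply/extP=> S; rewrite coefD coefZ !coef_interior mulr_sumr.
rewrite -big_split; apply: eq_bigr => i _ /=; rewrite /interior_coef.
by case: ifP => _; rewrite ?coefD ?coefZ; ring.
Qed.

HB.instance Definition _ X :=
  GRing.isLinear.Build K ext ext *:%R (interior X) (interior_is_linear X).

Lemma interior_linearl (x : K) X Y a :
  interior (x *: X + Y) a = x *: interior X a + interior Y a.
Proof.
apply/extP=> S; rewrite coefD coefZ !coef_interior mulr_sumr -big_split.
by apply: eq_bigr => i _ /=; rewrite !mxE; ring.
Qed.

Lemma big_subset_setU1 i S (F : {set 'I_N} -> K) : i \notin S ->
  \sum_(T : {set 'I_N} | T \subset i |: S) F T =
  \sum_(T : {set 'I_N} | T \subset S) (F T + F (i |: T)).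
Proof.
move=> nSi; rewrite (bigID [pred T : {set _} | i \in T]) /= addrC big_split /=.
congr (_ + _).
  apply: eq_bigl => T; apply/andP/idP => [[sT nTi]|sT].
    apply/subsetP=> j Tj; have := subsetP sT j Tj; rewrite !inE.
    by case/orP=> // /eqP eji; rewrite -eji Tj in nTi.
  by rewrite subsetU ?sT ?orbT // (contra (subsetP sT i)).
rewrite -(big_subset_union _ (T := [set i])) ?disjoints1 //; last first.
  by rewrite disjoint_sym disjoints1.
by apply: eq_bigl => T; rewrite sub1set andbC.
Qed.

(** The interior product is an odd derivation. By linearity X may be e_i. If i
is not in S, the subsets of i |: S without and with i give the two terms on the
right. If i is in S, each subset T of S without i contributes to the first term
what i |: T removes from the second. *)
Lemma interiorM X a b : interior X (a * b) = interior X a * b + grinv a * interior X b.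
Proof.
apply/extP=> S; rewrite coefD !coefM !coef_interior -big_split /=.
under [RHS]eq_bigr => T _.
  rewrite !coef_interior coef_grinv mulr_suml !mulr_sumr -big_split /=; over.
rewrite exchange_big; apply: eq_bigr => i _ /=.
rewrite -[X in _ = X]/(\sum_(T : {set 'I_N} | T \subset S) _).
transitivity (X 0 i * \sum_(T : {set 'I_N} | T \subset S)
  (-1) ^+ inversions T (S :\: T) *
    (interior_coef i a T * coef b (S :\: T) +
     (-1) ^+ #|T| * coef a T * interior_coef i b (S :\: T))); last first.
  by rewrite mulr_sumr; apply: eq_bigr => T _; ring.
have nTi T U : i \notin U -> T \subset U -> i \notin T.
  by move=> nUi sTU; apply: contra (subsetP sTU i) nUi.
have eW T U : T \subset U -> i \in U -> i \notin T ->
    U :\: T = i |: (U :\: (i |: T)) /\ i \notin U :\: (i |: T).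
  move=> sTU Ui nTi'; rewrite !inE eqxx; split=> //.
  apply/setP=> j; rewrite !inE; case: eqP => [->|//].
  by rewrite Ui nTi'.
have sgn2 n : (-1) ^+ n * (-1) ^+ n = 1 :> K by rewrite -expr2 sqrr_sign.
have sgnT T : i \notin T -> (-1) ^+ #|T| =
    (-1) ^+ inversions [set i] T * (-1) ^+ inversions T [set i] :> K.
  move=> Ti; rewrite -exprD inversionsC ?disjoints1 //.
  by rewrite cards1 mul1n.
have d1 T : i \notin T -> [disjoint [set i] & T] by rewrite disjoints1.
congr (_ * _); rewrite {1}/interior_coef; case: ifPn => [Si|nSi].
  rewrite -{1}(setD1K Si) big_subset_setU1 ?setD11 // big1 // => T sT.
  have Ti : i \notin T by apply: nTi sT; rewrite setD11.
  have [] := eW T S (subset_trans sT (subsetDl _ _)) Si Ti.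
  set W := S :\: (i |: T) => -> Wi.
  rewrite cardsU1 Ti /interior_coef !setU11 (negPf Ti) (negPf Wi).
  rewrite inversionsUr ?inversionsUl ?d1 // !exprD sgnT //.
  have := sgn2 (inversions [set i] W).
  set x := _ ^+ inversions [set i] W; move=> x2.
  set y := _ ^+ inversions [set i] T; set z := _ ^+ inversions T [set i].
  set t := _ ^+ inversions T W.
  transitivity ((1 - x * x) * (t * y * z * coef a (i |: T) * coef b (i |: W))).
    by ring.
  by rewrite x2 subrr mul0r.
rewrite coefM big_subset_setU1 // mulr_sumr; apply: eq_bigr => T sT.
have Ti : i \notin T by apply: nTi sT.
have [] := eW T (i |: S) (subset_trans sT (subsetUr _ _)) (setU11 _ _) Ti.
have -> : (i |: S) :\: (i |: T) = S :\: T.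
  by rewrite -setDDl setU1K.
move=> -> Wi.
rewrite /interior_coef (negPf Ti) (negPf Wi) -{1}(setU_setD sT).
have dTW : [disjoint T & S :\: T] by rewrite disjoint_sym disjoint_setD.
rewrite !(inversionsUr _ dTW) !inversionsUr ?inversionsUl ?d1 // !exprD sgnT //.
have := sgn2 (inversions [set i] (S :\: T)).
set x := _ ^+ inversions [set i] _; move=> x2.
set y := _ ^+ inversions [set i] T; set z := _ ^+ inversions T [set i].
set t := _ ^+ inversions T _.
transitivity (t * y * (z * coef a T * (x * coef b (i |: (S :\: T))) +
                       x * x * coef a (i |: T) * coef b (S :\: T))).
  by ring.
by rewrite x2; ring.
Qed.

End Contraction.

(** * The pairing and its reflections *)

Section Pairing.
Variables (K : numFieldType) (N : nat).
Implicit Types (u v w : 'rV[K]_(N + N)) (x : K).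

Lemma pairing_diag u : pairing u u = eval_covector (rsubmx u) (lsubmx u).
Proof. by rewrite /pairing -mulr2n -[X in _ * X]mulr_natl mulKf // pnatr_eq0. Qed.

Lemma pairingE u v : pairing u v =
  \sum_i 2^-1 * (u 0 (rshift N i) * v 0 (lshift N i) +
                  v 0 (rshift N i) * u 0 (lshift N i)).
Proof.
rewrite /pairing /eval_covector -big_split mulr_sumr.
by apply: eq_bigr => i _; rewrite !mxE.
Qed.

Lemma pairingC u v : pairing u v = pairing v u.
Proof. by rewrite !pairingE; apply: eq_bigr => i _; rewrite addrC. Qed.

Lemma pairing_linear x u v w :
  pairing (x *: u + v) w = x * pairing u w + pairing v w.
Proof.
rewrite !pairingE mulr_sumr -big_split.
by apply: eq_bigr => i _; rewrite /= !mxE; ring.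
Qed.

Lemma pairingDl u v w : pairing (u + v) w = pairing u w + pairing v w.
Proof. by rewrite -[u]scale1r pairing_linear mul1r scale1r. Qed.

Lemma pairing0l w : pairing (0 : 'rV[K]_(N + N)) w = 0.
Proof.
by rewrite pairingE big1 // => i _; rewrite !mxE mul0r mulr0 addr0 mulr0.
Qed.

Lemma pairingZl x u w : pairing (x *: u) w = x * pairing u w.
Proof. by rewrite -[x *: u]addr0 pairing_linear pairing0l addr0. Qed.

Lemma pairingNl u w : pairing (- u) w = - pairing u w.
Proof. by rewrite -scaleN1r pairingZl mulN1r. Qed.

Lemma pairingDr u v w : pairing u (v + w) = pairing u v + pairing u w.
Proof. by rewrite pairingC pairingDl !(pairingC u). Qed.

Lemma pairingZr x u w : pairing u (x *: w) = x * pairing u w.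
Proof. by rewrite pairingC pairingZl pairingC. Qed.

Lemma pairingNr u w : pairing u (- w) = - pairing u w.
Proof. by rewrite pairingC pairingNl pairingC. Qed.

Definition pairing_bilinear :=
  (pairingDl, pairingDr, pairingZl, pairingZr, pairingNl, pairingNr).

Definition reflection u v := v - (2 * pairing v u / pairing u u) *: u.

Lemma reflection_isometry u v w : pairing u u != 0 ->
  pairing (reflection u v) (reflection u w) = pairing v w.
Proof.
move=> q0; rewrite /reflection !pairing_bilinear (pairingC u w).
by field.
Qed.

Lemma reflectionK u v : pairing u u != 0 ->
  reflection u (reflection u v) = v.
Proof.
move=> q0; rewrite {1}/reflection !pairing_bilinear; apply/rowP=> j.
by rewrite !mxE; field.
Qed.

Definition gram : 'M[K]_(N + N) := block_mx 0 (2^-1)%:M (2^-1)%:M 0.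

(** Matrix form of the pairing, which makes reflections into matrices. *)
Lemma pairing_gram u v : u *m gram *m v^T = (pairing u v)%:M.
Proof.
rewrite [LHS]mx11_scalar /pairing /eval_covector; congr (_%:M).
rewrite -[u]hsubmxK -[v]hsubmxK /gram mul_row_block !mulmx0 add0r addr0.
rewrite !mul_mx_scalar tr_row_mx mul_row_col !row_mxKl !row_mxKr.
rewrite -!scalemxAl mxE 2!mxE [in X in _ + X]mxE -mulrDr !mxE.
congr (_ * (_ + _)).
  by apply: eq_bigr => j _; rewrite [_^T _ _]mxE.
by apply: eq_bigr => j _; rewrite [_^T _ _]mxE mulrC.
Qed.

Definition reflection_mx u : 'M[K]_(N + N) :=
  1%:M - (2 / pairing u u) *: (gram *m u^T *m u).

Lemma mul_reflection_mx u v : v *m reflection_mx u = reflection u v.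
Proof.
rewrite /reflection_mx mulmxBr mulmx1 -scalemxAr !mulmxA pairing_gram.
by rewrite mul_scalar_mx scalerA /reflection mulrAC.
Qed.

End Pairing.

(** * Complexification of real data *)

Section Complexification.
Variables (R : realType) (M : nat).
Local Notation C := R[i].
Local Notation cx := (@complexify_mx R _ _).
Local Notation im := (Complex 0 1 : C).
Implicit Types (u v : 'rV[C]_(M + M)) (r s : 'rV[R]_(M + M)).

Lemma conj_complexify p (r : 'rV[R]_p) :
  map_mx conjc (complexify_mx r) = complexify_mx r.
Proof. by apply/rowP=> i; rewrite !mxE conjc_real. Qed.

Lemma complexify_mul p q t (A : 'M[R]_(p, q)) (B : 'M[R]_(q, t)) :
  cx (A *m B) = cx A *m cx B.
Proof. exact: map_mxM. Qed.

Lemma complexify_scale p q x (A : 'M[R]_(p, q)) :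
  cx (x *: A) = x%:C%C *: cx A.
Proof. exact: map_mxZ. Qed.

Lemma complexify_sub p q (A B : 'M[R]_(p, q)) : cx (A - B) = cx A - cx B.
Proof. exact: map_mxB. Qed.

Lemma complexify_pairing r s : pairing (cx r) (cx s) = (pairing r s)%:C%C.
Proof.
rewrite !pairingE rmorph_sum; apply: eq_bigr => i _.
by rewrite rmorphM rmorphD !rmorphM fmorphV rmorph_nat !mxE.
Qed.

Lemma complexify_decomp u :
  u = cx (map_mx (@complex.Re R) u) + im *: cx (map_mx (@complex.Im R) u).
Proof.
apply/rowP=> j; rewrite !mxE; case: (u 0 j) => x y /=.
by apply/eqP; rewrite eq_complex /= !(mul0r, mul1r, mulr0, subr0, addr0, add0r) !eqxx.
Qed.

Lemma mul_im_im : im * im = -1.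
Proof. by rewrite -expr2 sqr_i. Qed.

(** The imaginary part of an equation between combinations of real matrices. *)
Lemma complexify_Im p q (z : C) (A B A' B' : 'M[R]_(p, q)) :
  cx A' + z *: cx B' = im *: (cx A + z *: cx B) ->
  complex.Im z *: B' = A + complex.Re z *: B.
Proof.
move=> e; apply/matrixP=> i j;
  have := congr1 (fun M : 'M[C]_(p, q) => complex.Im (M i j)) e.
rewrite !mxE; case: z {e} => x y /=.
move: (A i j) (B i j) (A' i j) (B' i j) => t1 t2 t3 t4 h.
have -> : y * t4 = 0 + (x * 0 + y * t4) by ring.
by rewrite h; ring.
Qed.

Lemma complexify_gram : cx (gram R M) = gram C M.
Proof.
rewrite /complexify_mx /gram map_block_mx !map_mx0.
by rewrite map_scalar_mx fmorphV rmorph_nat.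
Qed.

Lemma complexify_reflection_mx r :
  cx (reflection_mx r) = reflection_mx (cx r).
Proof.
rewrite /reflection_mx complexify_sub complexify_scale !complexify_mul.
rewrite complexify_pairing complexify_gram fmorph_div rmorph_nat.
have -> : cx r^T = (cx r)^T by rewrite /complexify_mx map_trmx.
by have -> : cx (1%:M : 'M[R]_(M + M)) = 1%:M by apply: map_mx1.
Qed.

End Complexification.

(** * The Clifford action *)

Section CliffordAction.
Variables (K : numFieldType) (N : nat).
Local Notation ext := (ext K N).
Implicit Types (a b : ext) (S T : {set 'I_N}) (X xi : 'rV[K]_N).
Implicit Types (u v : 'rV[K]_(N + N)).

Lemma eq_opp_eq0 (V : lmodType K) (x : V) : x = - x -> x = 0.
Proof.
move/eqP; rewrite -addr_eq0 -mulr2n -scaler_nat scaler_eq0 pnatr_eq0 /=.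
by move/eqP.
Qed.

Lemma interior1 X : interior X 1 = 0 :> ext.
Proof.
have := interiorM X 1 1; rewrite rmorph1 !mulr1 mul1r => /esym/eqP.
by rewrite -subr_eq0 addrK => /eqP.
Qed.

Lemma homogeneous_interior X p a :
  homogeneous p.+1 a -> homogeneous p (interior X a).
Proof.
move=> ha S nS; rewrite -/(coef _ S) coef_interior big1 // => i _.
rewrite /interior_coef; case: ifPn => Si; first by rewrite mulr0.
by rewrite [coef a _]ha ?mulr0 // cardsU1 Si.
Qed.

Lemma interior_cov X xi : interior X (cov xi) = (eval_covector xi X)%:A :> ext.
Proof.
apply/extP=> S; rewrite coefZ coef1 coef_interior.
have [->|nS] := eqVneq S set0.
  rewrite mulr1; apply: eq_bigr => i _.
  by rewrite /interior_coef inE inversions0r setU0 coef_cov1 mul1r mulrC.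
rewrite mulr0 big1 // => i _; rewrite /interior_coef; case: ifPn => Si.
  by rewrite mulr0.
rewrite [coef _ _]homogeneous_cov ?mulr0 // cardsU1 Si eqSS.
by rewrite cards_eq0.
Qed.

(** Contractions by e_i and e_j anticommute, so the double sum is antisymmetric. *)
Lemma interior_interior X a : interior X (interior X a) = 0.
Proof.
apply: eq_opp_eq0; apply/extP=> S; rewrite coefN.
pose c i j := if i \in S then 0 else (-1) ^+ inversions [set i] S *
  (if j \in i |: S then 0 else
   (-1) ^+ inversions [set j] (i |: S) * coef a (j |: (i |: S))).
have cN i j : c i j = - c j i.
  rewrite /c !inE; have [->|nij] := eqVneq i j.
    by case: (j \in S); rewrite ?mulr0 oppr0.
  case Si: (i \in S); case Sj: (j \in S); rewrite /= ?mulr0 ?oppr0 //.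
  rewrite setUCA !inversionsUr ?disjoints1 ?Si ?Sj // !exprD.
  have : [disjoint [set i] & [set j]] by rewrite disjoints1 inE.
  move=> /inversionsC; rewrite !cards1.
  set m := inversions [set i] [set j]; set n := inversions [set j] [set i].
  by case: m n => [|[|m]] [|[|n]] //= _; rewrite !(expr0, expr1); ring.
have cE : coef (interior X (interior X a)) S = \sum_i \sum_j X 0 i * X 0 j * c i j.
  rewrite coef_interior; apply: eq_bigr => i _; rewrite /interior_coef /c.
  case: ifP => _.
    by rewrite mulr0 big1 // => j _; rewrite mulr0.
  rewrite coef_interior !mulr_sumr; apply: eq_bigr => j _.
  by rewrite /interior_coef; move: (if _ then _ else _) => y; ring.
rewrite cE [LHS]exchange_big /= -sumrN; apply: eq_bigr => i _.
rewrite -sumrN; apply: eq_bigr => j _.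
by rewrite (cN j i); move: (c i j) => y; ring.
Qed.

Lemma cov_cov xi : cov xi * cov xi = 0 :> ext.
Proof.
apply: eq_opp_eq0; rewrite {1}covC (homogeneous_grinv (homogeneous_cov xi)).
by rewrite expr1 scaleN1r mulNr.
Qed.

Lemma grinv_cov xi : grinv (cov xi) = - cov xi :> ext.
Proof. by rewrite (homogeneous_grinv (homogeneous_cov xi)) expr1 scaleN1r. Qed.

Lemma interiorD X a b : interior X (a + b) = interior X a + interior X b.
Proof. exact: linearD. Qed.

Lemma interiorB X a b : interior X (a - b) = interior X a - interior X b.
Proof. exact: raddfB. Qed.

Lemma interiorZ X x a : interior X (x *: a) = x *: interior X a.
Proof. exact: linearZ. Qed.

Lemma interior0 X : interior X 0 = 0 :> ext.
Proof. exact: linear0. Qed.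

(** The Clifford action with values in [ext], so that sums of spinors are sums in
the exterior ring. *)
Definition clif u a : ext := clifford u a.

Lemma clifE u a :
  clif u a = interior (lsubmx u) a + cov (rsubmx u) * a :> ext.
Proof. by []. Qed.

Lemma clifDr u a b :
  clif u (a + b) = clif u a + clif u b :> ext.
Proof. by rewrite !clifE interiorD mulrDr addrACA. Qed.

Lemma clifZr u x a : clif u (x *: a) = x *: (clif u a : ext) :> ext.
Proof. by rewrite !clifE interiorZ -scalerAr -scalerDr. Qed.

Lemma clif0r u : clif u (0 : ext) = 0 :> ext.
Proof. by rewrite clifE interior0 mulr0 addr0. Qed.

Lemma clif_linearl (x : K) u v a :
  clif (x *: u + v) a = x *: (clif u a : ext) + clif v a :> ext.
Proof.
rewrite !clifE !linearP /= interior_linearl mulrDl -scalerAl scalerDr.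
by rewrite !addrA; congr (_ + _); rewrite addrAC.
Qed.

Lemma clifD u v a :
  clif (u + v) a = clif u a + clif v a :> ext.
Proof. by rewrite -[u]scale1r clif_linearl !scale1r. Qed.

Lemma clif_sqr u a : clif u (clif u a) = pairing u u *: a :> ext.
Proof.
rewrite !clifE interiorD interior_interior add0r interiorM interior_cov grinv_cov.
rewrite mulrDr mulrA cov_cov mul0r addr0 mulNr addrNK pairing_diag.
by rewrite -scalerAl mul1r.
Qed.

(** Polarization of [clif_sqr]. *)
Lemma clif_anticommute u v a :
  clif u (clif v a) + clif v (clif u a) =
  (2 * pairing u v) *: a :> ext.
Proof.
have := clif_sqr (u + v) a.
rewrite !clifD !(clifDr _ (clif u a) (clif v a)) !clif_sqr.
have -> : pairing (u + v) (u + v) =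
    pairing u u + (2 * pairing u v + pairing v v).
  by rewrite !pairing_bilinear (pairingC v u); ring.
rewrite -addrA !scalerDl => /addrI; rewrite addrA => /addIr.
exact.
Qed.

End CliffordAction.

(** * Exponentials of 2-forms *)

Section Exponential.
Variables (K : numFieldType) (N : nat).
Local Notation ext := (ext K N).
Implicit Types (a b c : ext) (X xi : 'rV[K]_N).

Lemma wedge_powE a j : wedge_pow a j = a ^+ j :> ext.
Proof. by elim: j => [//|j IHj]; rewrite exprS -IHj. Qed.

Definition ext_exp a : ext := wedge_exp a.

Lemma ext_expE a :
  ext_exp a = \sum_(j < N.+1) (j`!%:R)^-1 *: a ^+ j :> ext.
Proof. by apply: eq_bigr => j _; rewrite wedge_powE. Qed.

Lemma interiorX X b j : homogeneous 2 b ->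
  interior X (b ^+ j.+1) = j.+1%:R *: (interior X b * b ^+ j).
Proof.
move=> hb; elim: j => [|j IHj]; first by rewrite expr1 mulr1 scale1r.
rewrite exprS interiorM IHj homogeneous2_grinv // -scalerAr mulrA.
rewrite (homogeneous2C _ hb) -mulrA -exprS -[j.+2]add1n natrD scalerDl.
by rewrite scale1r.
Qed.

Lemma homogeneous2_nilpotent b j :
  homogeneous 2 b -> (N < 2 * j)%N -> b ^+ j = 0.
Proof. by move=> hb ltNj; exact: (homogeneous_gt ltNj (homogeneousX hb)). Qed.

Lemma factS_inv j : (j.+1`!%:R)^-1 * j.+1%:R = (j`!%:R)^-1 :> K.
Proof. by rewrite factS natrM invfM mulrAC mulVf ?mul1r // pnatr_eq0. Qed.

(** Differentiation shifts the exponential series by one term; the top term lost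
on the right has degree 2N > N, hence vanishes. *)
Lemma interior_ext_exp X b : (0 < N)%N -> homogeneous 2 b ->
  interior X (ext_exp b) = interior X b * ext_exp b :> ext.
Proof.
move=> N_gt0 hb; rewrite !ext_expE mulr_sumr linear_sum [LHS]big_ord_recl /=.
rewrite interiorZ interior1 scaler0 add0r [RHS]big_ord_recr /=.
rewrite homogeneous2_nilpotent ?ltn_Pmull // scaler0 mulr0 addr0.
apply: eq_bigr => j _; rewrite interiorZ interiorX // -scalerAr scalerA.
by rewrite factS_inv.
Qed.

(** As c is even and squares to zero, the binomial formula keeps only its terms of
degree at most one in c. *)
Lemma ext_exp_addsq0 b c : homogeneous 2 b -> homogeneous 2 c ->
  c * c = 0 -> ext_exp (b + c) = ext_exp b * (1 + c) :> ext.
Proof.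
move=> hb hc c2; have bcC := homogeneous2C b hc.
have powD j : (b + c) ^+ j.+1 = b ^+ j.+1 + j.+1%:R *: (b ^+ j * c).
  elim: j => [|j IHj]; first by rewrite !expr1 mul1r scale1r.
  rewrite exprSr IHj mulrDl !mulrDr -exprSr -addrA; congr (_ + _).
  rewrite -!scalerAl -!mulrA c2 mulr0 scaler0 addr0 bcC mulrA -exprSr.
  by rewrite -[j.+2]add1n natrD scalerDl scale1r.
rewrite !ext_expE mulrDr mulr1 !(big_ord_recl N) /= !expr0 -addrA.
congr (_ + _); under eq_bigr => j _.
  by rewrite /= powD scalerDr scalerA factS_inv; over.
rewrite big_split /=; congr (_ + _).
rewrite -[X in _ = X * c](big_ord_recl N (fun j => (j`!%:R)^-1 *: b ^+ j)).
rewrite big_ord_recr /= mulrDl -[_ *: b ^+ N * c]scalerAl.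
rewrite (homogeneous_gt _ (homogeneousM (homogeneousX hb) hc)); last first.
  by rewrite mul2n -addnn addn2 ltnS -addnS leq_addr.
rewrite scaler0 addr0 mulr_suml; apply: eq_bigr => j _.
by rewrite scalerAl.
Qed.

End Exponential.

(** * Decomposable forms *)

Section Decomposable.
Variables (K : numFieldType) (N : nat).
Local Notation ext := (ext K N).
Implicit Types (a b : ext) (X xi : 'rV[K]_N) (k : nat).

Definition decomposable k a : Prop :=
  exists (c : K) (theta : 'M[K]_(k, N)), a = c *: (wedge_rows theta : ext).

Lemma wedge_rowsE k (theta : 'M[K]_(k, N)) :
  wedge_rows theta = \prod_(i < k) cov (row i theta) :> ext.
Proof. by []. Qed.

Lemma wedge_rows_col_mx k xi (theta : 'M[K]_(k, N)) :
  wedge_rows (col_mx xi theta) = cov xi * wedge_rows theta :> ext.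
Proof.
rewrite !wedge_rowsE big_ord_recl; congr (cov _ * _).
  have -> : ord0 = lshift k (ord0 : 'I_1) by apply/val_inj.
  by rewrite rowKu row_id.
apply: eq_bigr => i _; congr (cov _).
have -> : lift ord0 i = rshift 1 i by apply/val_inj.
by rewrite rowKd.
Qed.

Lemma decomposable_mul k xi a : decomposable k a -> decomposable k.+1 (cov xi * a).
Proof.
move=> [c [theta ->]]; exists c, (col_mx xi theta).
by rewrite -scalerAr -wedge_rows_col_mx.
Qed.

Lemma decomposableZ k x a : decomposable k a -> decomposable k (x *: a).
Proof. by move=> [c [theta ->]]; exists (x * c), theta; rewrite scalerA. Qed.

Lemma decomposable_factor k a :
  decomposable k.+1 a -> exists xi b, decomposable k b /\ a = cov xi * b.
Proof.
move=> [c [theta ->]].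
exists (usubmx (theta : 'M_(1 + k, N))).
exists (c *: (wedge_rows (dsubmx (theta : 'M_(1 + k, N))) : ext)).
split; first by exists c, (dsubmx (theta : 'M_(1 + k, N))).
rewrite -scalerAr -wedge_rows_col_mx.
by rewrite [X in _ = _ *: wedge_rows X]vsubmxK.
Qed.

Lemma homogeneous_decomposable k a : decomposable k a -> homogeneous k a.
Proof.
elim: k a => [|k IHk] a.
  move=> [c [theta ->]]; rewrite wedge_rowsE big_ord0.
  exact: homogeneousZ (@homogeneous1 _ _).
move/decomposable_factor=> [xi [b [/IHk hb ->]]].
exact: (homogeneousM (homogeneous_cov xi) hb).
Qed.

Lemma interior_cov_mul X xi a :
  interior X (cov xi * a) = eval_covector xi X *: a - cov xi * interior X a.
Proof. by rewrite interiorM interior_cov grinv_cov -scalerAl mul1r mulNr. Qed.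

Lemma eval_covectorZ x xi X :
  eval_covector (x *: xi) X = x * eval_covector xi X.
Proof.
rewrite /eval_covector mulr_sumr; apply: eq_bigr => i _.
by rewrite !mxE mulrA.
Qed.

Lemma eval_covectorB xi eta X :
  eval_covector (xi - eta) X = eval_covector xi X - eval_covector eta X.
Proof.
rewrite /eval_covector -sumrB; apply: eq_bigr => i _.
by rewrite !mxE mulrBl.
Qed.

(** Adapts the factorization of a to X. Induct on the factors: if X annihilates
all but the first, rescale that one; otherwise the remaining ones split off eta
with eta(X) = 1, and subtracting xi(X) eta from xi makes X annihilate it. *)
Lemma decomposable_split k X a : decomposable k a -> interior X a <> 0 ->
  exists k' xi b, [/\ k = k'.+1, a = cov xi * b, decomposable k' b,
    interior X b = 0 & eval_covector xi X = 1].
Proof.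
elim: k a => [|k IHk] a.
  move=> [c [theta ->]]; rewrite wedge_rowsE big_ord0 interiorZ interior1 scaler0.
  by case.
move/decomposable_factor=> [xi [b [db ->]]] nz.
have [ib|nib] := eqVneq (interior X b) 0.
  move: nz; rewrite interior_cov_mul ib mulr0 subr0 => nz.
  set x := eval_covector xi X in nz.
  have x0 : x != 0 by apply/eqP => x0; case: nz; rewrite x0 scale0r.
  exists k, (x^-1 *: xi), (x *: b); split => //.
  - rewrite linearZ /= -scalerAl -scalerAr scalerA mulVf ?scale1r //.
  - exact: decomposableZ.
  - by rewrite interiorZ ib scaler0.
  by rewrite eval_covectorZ mulVf.
have [k' [eta [b' [-> eb db' ib' e1]]]] := IHk b db (elimN eqP nib).
set x := eval_covector xi X.
exists k'.+1, eta, (cov (x *: eta - xi) * b'); split => //.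
- rewrite eb !mulrA; congr (_ * _); rewrite linearB linearZ /= mulrBr -scalerAr.
  by rewrite cov_cov scaler0 sub0r covC grinv_cov mulNr.
- exact: decomposable_mul.
- rewrite interior_cov_mul ib' mulr0 subr0 eval_covectorB eval_covectorZ e1 mulr1.
  by rewrite subrr scale0r.
Qed.

Lemma cov_mul_wedge_rows k (theta : 'M[K]_(k, N)) (x : 'rV_k) :
  cov (x *m theta) * (wedge_rows theta : ext) = 0.
Proof.
elim: k theta x => [|k IHk] theta x.
  by rewrite (flatmx0 theta) mulmx0 linear0 mul0r.
rewrite -[theta](vsubmxK (theta : 'M_(1 + k, N))) -[x](hsubmxK (x : 'rV_(1 + k))).
rewrite (mul_row_col (lsubmx (x : 'rV_(1 + k)))).
rewrite wedge_rows_col_mx linearD mulrDl /= !mulrA.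
rewrite [cov (rsubmx _ *m _) * _]covC grinv_cov -[X in _ + X]mulrA IHk mulr0 addr0.
rewrite (mx11_scalar (lsubmx _)) mul_scalar_mx linearZ /=.
by rewrite -scalerAl cov_cov scaler0 mul0r.
Qed.

(** A covector in the span of the factors kills their product, so each factor of a
nonzero product lies outside the span of the later ones. *)
Lemma wedge_rows_row_free k (theta : 'M[K]_(k, N)) :
  wedge_rows theta <> 0 :> ext -> row_free theta.
Proof.
elim: k theta => [|k IHk] theta.
  by move=> _; rewrite /row_free (flatmx0 theta) mxrank0.
rewrite -[theta](vsubmxK (theta : 'M_(1 + k, N))) wedge_rows_col_mx.
set xi := usubmx _; set th := dsubmx _ => nz.
have fth : row_free th by apply: IHk => th0; case: nz; rewrite th0 mulr0.
have nxi : ~~ (xi <= th)%MS.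
  by apply/negP=> /submxP[x ex]; apply: nz; rewrite ex cov_mul_wedge_rows.
suff: (1 + k <= \rank (col_mx xi th))%N by rewrite row_leq_rank.
rewrite -addsmxE -[k in (1 + k)%N](eqP fth) add1n rank_ltmx //.
rewrite /ltmx addsmxSr; apply: contra nxi; apply: submx_trans.
exact: addsmxSl.
Qed.

End Decomposable.

(** * Complex conjugation of forms *)

Section Conjugation.
Variables (R : realType) (N : nat).
Local Notation C := R[i].
Local Notation ext := (ext C N).
Implicit Types (a b : ext) (X xi : 'rV[C]_N).

Definition conj a : ext := conj_form a.

Lemma coef_conj a S : coef (conj a) S = (coef a S)^*%C.
Proof. by rewrite /coef ffunE. Qed.

Lemma conj_is_additive : additive conj.
Proof.
by move=> a b; apply/extP=> S; rewrite !(coef_conj, coefD, coefN) rmorphB.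
Qed.

Lemma conj_is_multiplicative : multiplicative conj.
Proof.
split=> [a b|]; apply/extP=> S; last by rewrite coef_conj coef1 conjc_nat.
rewrite coef_conj !coefM rmorph_sum; apply: eq_bigr => T _.
by rewrite !rmorphM /= !coef_conj rmorphXn rmorphN1.
Qed.

HB.instance Definition _ := GRing.isAdditive.Build ext ext conj conj_is_additive.
HB.instance Definition _ :=
  GRing.isMultiplicative.Build ext ext conj conj_is_multiplicative.

Lemma conjZ x a : conj (x *: a) = x^*%C *: conj a.
Proof. by apply/extP=> S; rewrite !(coef_conj, coefZ) rmorphM. Qed.

Lemma conj_cov xi : conj (cov xi) = cov (map_mx conjc xi).
Proof.
apply/extP=> S; rewrite coef_conj !coef_cov rmorph_sum.
by apply: eq_bigr => i _; rewrite mxE.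
Qed.

Lemma conj_interior X a : conj (interior X a) = interior (map_mx conjc X) (conj a).
Proof.
apply/extP=> S; rewrite coef_conj !coef_interior rmorph_sum.
apply: eq_bigr => i _; rewrite rmorphM mxE /interior_coef /=.
case: ifP => _; first by rewrite conjc0.
by rewrite rmorphM rmorphXn rmorphN1 coef_conj.
Qed.

Lemma homogeneous_conj p a : homogeneous p a -> homogeneous p (conj a).
Proof.
move=> ha S nS; rewrite -/(coef _ S) coef_conj [coef a S]ha //.
exact: conjc0.
Qed.

End Conjugation.

(** * Clifford multiplication of a pure spinor by a real vector *)

Section TypeChange.
Variables (R : realType) (N : nat).
Local Notation C := R[i].
Local Notation ext := (ext C N).
Implicit Types (a b : ext) (X xi : 'rV[C]_N).

Lemma homogeneous1_grinv a : homogeneous 1 a -> grinv a = - a.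
Proof. by move/homogeneous_grinv ->; rewrite expr1 scaleN1r. Qed.

Lemma homogeneous1_sqr a : homogeneous 1 a -> a * a = 0.
Proof. by move/homogeneous1_cov => [xi ->]; rewrite cov_cov. Qed.

Lemma homogeneous1C a b : homogeneous 1 a -> a * b = grinv b * a.
Proof. by move/homogeneous1_cov => [xi ->]; rewrite covC. Qed.

Lemma homogeneous1_anticomm a b :
  homogeneous 1 a -> homogeneous 1 b -> a * b = - (b * a).
Proof. by move=> ha hb; rewrite homogeneous1C // homogeneous1_grinv // mulNr. Qed.

Lemma homogeneous1_swap k a b : homogeneous 1 a -> homogeneous k b ->
  b * a = (-1) ^+ k *: (a * b).
Proof.
move=> ha hb.
rewrite (homogeneous1C b ha) (homogeneous_grinv hb) -scalerAl scalerA.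
by rewrite -expr2 sqrr_sign scale1r.
Qed.

Lemma homogeneous1_shuffle k a a' b b' : homogeneous 1 a' -> homogeneous k b ->
  a * b * (a' * b') = (-1) ^+ k *: (a * a' * (b * b')).
Proof.
move=> ha' hb; rewrite -mulrA [b * (_ * _)]mulrA (homogeneous1_swap ha' hb).
by rewrite -scalerAl -scalerAr !mulrA.
Qed.

Lemma homogeneous2XC b j a : homogeneous 2 b -> b ^+ j * a = a * b ^+ j.
Proof.
by move=> hb; rewrite [RHS](commrX j (esym (homogeneous2C a hb))).
Qed.

Lemma ext_expC b a : homogeneous 2 b -> ext_exp b * a = a * ext_exp b.
Proof.
move=> hb; rewrite ext_expE mulr_suml mulr_sumr; apply: eq_bigr => j _.
by rewrite -scalerAl -scalerAr homogeneous2XC.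
Qed.

Lemma grinv_ext_exp b : homogeneous 2 b -> grinv (ext_exp b) = ext_exp b.
Proof.
move=> hb; rewrite ext_expE raddf_sum; apply: eq_bigr => j _.
apply/extP=> S; rewrite coef_grinv.
have [->//|nS] := eqVneq #|S| (2 * j)%N.
  by rewrite exprM sqrrN !expr1n mul1r.
by rewrite coefZ [coef _ S](homogeneousX hb) // !mulr0.
Qed.

(** The exponential intertwines the Clifford action with the one twisted by b:
contracting [ext_exp b] yields the covector iota_X b. *)
Lemma clif_exp u b a : (0 < N)%N -> homogeneous 2 b ->
  clif u (ext_exp b * a) =
  ext_exp b * ((cov (rsubmx u) + interior (lsubmx u) b) * a + interior (lsubmx u) a).
Proof.
move=> N0 hb; rewrite clifE interiorM interior_ext_exp // grinv_ext_exp //.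
rewrite -(ext_expC (interior _ b) hb) [cov _ * (_ * a)]mulrA.
rewrite -(ext_expC (cov _) hb) -!mulrA -!mulrDr mulrDl.
by rewrite addrC addrA.
Qed.

Lemma subr_telescope (V : zmodType) (x y z t : V) :
  x - y + (z - x - (t - y)) = z - t.
Proof. by rewrite opprB addrA [x - y + _]addrC !addrA !subrK. Qed.

(** The spinor exp(b) Om, of type k, is multiplied by a real vector X + xi of
square q <> 0. The form del stands for 2 i omega, where omega is the imaginary
part of b. *)
Section TypeChangeStep.
Variables (n k : nat) (b Om del eta : ext) (X xi : 'rV[C]_N) (q : C).
Hypotheses (N_gt0 : (0 < N)%N) (dimN : N = (2 * n)%N) (le_kn : (k <= n)%N).
Hypotheses (hb : homogeneous 2 b) (dOm : decomposable k Om).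
Hypotheses (X_real : map_mx conjc X = X) (xi_real : map_mx conjc xi = xi).
Hypotheses (xiX : eval_covector xi X = q) (q_neq0 : q != 0).
Hypotheses (delE : del = b - conj b) (etaE : eta = cov xi + interior X b).
Hypothesis nondeg : del ^+ (n - k) * Om * conj Om <> 0.

Let q_real : q^*%C = q.
Proof.
rewrite -xiX /eval_covector rmorph_sum; apply: eq_bigr => i _.
by rewrite rmorphM -[in RHS]X_real -[in RHS]xi_real !mxE.
Qed.

Let conj_interiorX a : conj (interior X a) = interior X (conj a).
Proof. by rewrite conj_interior X_real. Qed.

Let hdel : homogeneous 2 del.
Proof. by rewrite delE; apply: homogeneousB => //; apply: homogeneous_conj. Qed.

Let heta : homogeneous 1 eta.
Proof.
rewrite etaE; apply: homogeneousD; first exact: homogeneous_cov.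
exact: homogeneous_interior.
Qed.

Let interior_eta : interior X eta = q%:A.
Proof. by rewrite etaE interiorD interior_interior addr0 interior_cov xiX. Qed.

Let interior_del : interior X del = eta - conj eta.
Proof.
rewrite etaE rmorphD /= conj_cov xi_real conj_interiorX opprD addrACA subrr.
by rewrite add0r delE interiorB.
Qed.

(** The degree N + 1 form eta del^(n-k) Om conj Om is zero; contracting it with X
expresses q times the top form through eta iota_X(del^(n-k)) Om conj Om. As
iota_X del = eta - conj eta, this is the new top form up to a nonzero scalar.
For k = n there is no factor del, and the contraction of the top form is zero:
this excludes k = n. *)
Lemma type_increase : interior X Om = 0 ->
  [/\ (k < n)%N, decomposable k.+1 (eta * Om),
     clif (row_mx X xi) (ext_exp b * Om) = ext_exp b * (eta * Om) &
     del ^+ (n - k.+1) * (eta * Om) * conj (eta * Om) <> 0].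
Proof.
move=> iOm.
have iOmc : interior X (conj Om) = 0 by rewrite -conj_interiorX iOm raddf0.
have hOm := homogeneous_decomposable dOm.
pose Psi := Om * conj Om.
have iPsi : interior X Psi = 0 by rewrite interiorM iOm iOmc mul0r mulr0 addr0.
have top0 : eta * (del ^+ (n - k) * Psi) = 0.
  apply: (homogeneous_gt _ (homogeneousM heta (homogeneousM
    (homogeneousX hdel) (homogeneousM hOm (homogeneous_conj hOm))))).
  by rewrite addnn -mul2n -mulnDr subnK // -dimN.
(* Contract top0 with X and use eta(X) = q. *)
have nz : eta * interior X (del ^+ (n - k) * Psi) <> 0.
  have := congr1 (interior X) top0.
  rewrite interior0 interiorM interior_eta homogeneous1_grinv // mulNr -scalerAl mul1r.
  move/eqP; rewrite subr_eq0 => /eqP <- /eqP.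
  by rewrite scaler_eq0 (negPf q_neq0) /Psi mulrA => /eqP.
have lt_kn : (k < n)%N.
  rewrite ltn_neqAle le_kn andbT; apply/eqP=> ekn; apply: nz.
  by rewrite ekn subnn mul1r iPsi mulr0.
split=> //.
- have [t et] := homogeneous1_cov heta.
  by rewrite et; apply: decomposable_mul.
- by rewrite clif_exp // row_mxKl row_mxKr -etaE iOm addr0.
move=> z; apply: nz; rewrite -(subnSK lt_kn) interiorM iPsi mulr0 addr0.
rewrite interiorX // interior_del -scalerAl -scalerAr !mulrA mulrBr.
rewrite homogeneous1_sqr // sub0r -(homogeneous2XC _ _ hdel) mulrN mulNr.
move: z; rewrite rmorphM /= -mulrA (homogeneous1_shuffle _ _ _ hOm); last first.
  exact: homogeneous_conj.
rewrite -scalerAr -/Psi => /eqP; rewrite scaler_eq0 signr_eq0 /= => /eqP.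
by rewrite mulNr /Psi -!mulrA => ->; rewrite oppr0 scaler0.
Qed.

(** With Om = th Om', the new 2-form is b + g for g = eta th, so that
del' = del + g - conj g. Its contraction with X is q (th - conj th), and g and
conj g are killed by th conj th. So th times the contraction of the new top form
is, up to a nonzero scalar, th conj th del^(n-k) Om' conj Om', the old top
form up to sign. *)
Lemma type_decrease : interior X Om <> 0 ->
  exists k' b' Om', [/\ k = k'.+1, homogeneous 2 b', decomposable k' Om',
     clif (row_mx X xi) (ext_exp b * Om) = ext_exp b' * Om' &
     (b' - conj b') ^+ (n - k') * Om' * conj Om' <> 0].
Proof.
move=> /(decomposable_split dOm) [k' [t [Om' [ek eOm dOm' iOm' tX]]]].
have hOm' := homogeneous_decomposable dOm'.
pose th : ext := cov t; pose thc := conj th.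
have hth : homogeneous 1 th by apply: homogeneous_cov.
have hthc : homogeneous 1 thc by apply: homogeneous_conj.
have ith : interior X th = 1 by rewrite interior_cov tX scale1r.
have ithc : interior X thc = 1 by rewrite -conj_interiorX ith rmorph1.
pose g := eta * th.
have hg : homogeneous 2 g := homogeneousM heta hth.
have hgc : homogeneous 2 (conj g) := homogeneous_conj hg.
have thg : th * g = 0.
  rewrite /g (homogeneous1_anticomm heta hth) mulrN mulrA homogeneous1_sqr //.
  by rewrite mul0r oppr0.
have thgc : thc * conj g = 0.
  by rewrite -rmorphM thg rmorph0.
have gg : g * g = 0 by rewrite {1}/g -mulrA thg mulr0.
exists k', (b + g), Om'; split=> //.
- exact: homogeneousD.
- rewrite clif_exp // row_mxKl row_mxKr -etaE eOm interior_cov_mul tX scale1r.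
  rewrite iOm' mulr0 subr0.
  by rewrite ext_exp_addsq0 // -mulrA [(1 + g) * _]mulrDl mul1r addrC !mulrA.
pose del' := b + g - conj (b + g); pose Psi := Om' * conj Om'.
have edel' : del' = del + (g - conj g).
  by rewrite /del' rmorphD opprD addrACA -delE.
have hdel' : homogeneous 2 del'.
  by rewrite edel'; apply: homogeneousD => //; apply: homogeneousB.
have ig : interior X g = q *: th - eta.
  by rewrite interiorM interior_eta -scalerAl mul1r homogeneous1_grinv // ith mulr1.
have interior_del' : interior X del' = q *: (th - thc).
  rewrite edel' (interiorD _ del) interior_del (interiorB _ g) -conj_interiorX.
  rewrite ig rmorphB /=.
  by rewrite conjZ q_real -/thc scalerBr subr_telescope.
have iPsi : interior X Psi = 0.
  by rewrite interiorM iOm' -conj_interiorX iOm' raddf0 mul0r mulr0 addr0.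
(* th kills g and conj th kills conj g; everything else is even. *)
have ccdel' j : th * thc * del' ^+ j = th * thc * del ^+ j.
  have cc1 : th * thc * del' = th * thc * del.
    rewrite edel' (mulrDr _ del) (mulrBr _ g) -(mulrA th thc (conj g)) thgc.
    rewrite mulr0 subr0 -(mulrA th thc g) -(homogeneous2C thc hg) (mulrA th g).
    by rewrite thg mul0r addr0.
  elim: j => [|j IHj]; first by rewrite !expr0.
  rewrite exprSr mulrA IHj -(homogeneous2XC j (th * thc) hdel).
  rewrite -(mulrA _ _ del') cc1 mulrA (homogeneous2XC j (th * thc) hdel).
  by rewrite exprSr mulrA.
have ep : (n - k' = (n - k).+1)%N by rewrite ek subnSK // -ek.
rewrite ep -mulrA -/del' -/Psi => z; apply: nondeg.
have := congr1 (fun a => th * interior X a) z.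
move: (del') hdel' interior_del' ccdel' => d hd id ccd.
rewrite interior0 mulr0 interiorM iPsi mulr0 addr0 interiorX // id.
rewrite -!scalerAl -!scalerAr !mulrA mulrBr homogeneous1_sqr // sub0r !mulNr.
rewrite ccd => /eqP; rewrite !scaler_eq0 pnatr_eq0 (negPf q_neq0) oppr_eq0 /=.
rewrite -(homogeneous2XC _ _ hdel) -mulrA => /eqP z'.
rewrite -mulrA eOm rmorphM /= (homogeneous1_shuffle _ _ _ hOm') //.
by rewrite -scalerAr [del ^+ _ * _]mulrA z' scaler0.
Qed.

End TypeChangeStep.
End TypeChange.

(** * The type under a reflection *)

Section TypeOfStructure.
Variables (R : realType) (N n : nat).
Local Notation C := R[i].
Local Notation ext := (ext C N).
Implicit Types (J : 'M[R]_(N + N)) (b Om rho : ext) (u v : 'rV[C]_(N + N)).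

Lemma complex_form_imag (B w : Defs.form R N) :
  (complex_form B w : ext) - conj (complex_form B w) =
  (2 * Complex 0 1) *: (complex_form w 0 : ext).
Proof.
apply/extP=> S; rewrite coefD coefN coef_conj coefZ /coef !ffunE.
rewrite subcJ /= mulrAC; congr (_ * _).
Qed.

Lemma scaled_power_neq0 (x : C) b Om Om' p : x != 0 ->
  (x *: b) ^+ p * Om * Om' <> 0 <-> b ^+ p * Om * Om' <> 0.
Proof.
move=> x0; rewrite exprZn -!scalerAl; split=> nz z; apply: nz.
  by rewrite z scaler0.
by move/eqP: z; rewrite scaler_eq0 expf_eq0 (negPf x0) andbF => /eqP.
Qed.

Lemma two_im_neq0 : 2 * Complex 0 1 != 0 :> C.
Proof.
rewrite mulf_neq0 ?pnatr_eq0 // eq_complex /= oner_eq0 andbF //.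
Qed.

(** Real 2-forms B and omega are the two parts of one complex 2-form b, with
b - conj b = 2 i omega; and a decomposable form which is nonzero has
independent factors and a nonzero scalar. *)
Lemma has_typeP J k : has_type n J k <-> (k <= n)%N /\ exists b Om,
  [/\ homogeneous 2 b, decomposable k Om,
      spinor_generator J (ext_exp b * Om) &
      (b - conj b) ^+ (n - k) * Om * conj Om <> 0].
Proof.
split=> [[le_kn]|[le_kn]].
  move=> [B [w [c [theta [hB hw c0 fth [sg nd]]]]]]; split=> //.
  exists (complex_form B w), (c *: (wedge_rows theta : ext)); split=> //.
  - move=> S nS; rewrite ffunE hB // hw //.
  - by exists c, theta.
  rewrite complex_form_imag; apply/(scaled_power_neq0 _ _ _ _ two_im_neq0) => z.
  by case/eqP: nd; rewrite wedge_powE.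
move=> [b [Om [hb [c [theta eOm]] sg nd]]]; split=> //.
pose B : Defs.form R N := [ffun S => complex.Re (coef b S)].
pose w : Defs.form R N := [ffun S => complex.Im (coef b S)].
have eb : complex_form B w = b.
  by apply/ffunP => S; rewrite !ffunE /coef; case: (b S).
have nOm : Om <> 0 by move=> Om0; apply: nd; rewrite Om0 mulr0 mul0r.
exists B, w, c, theta; split.
- by move=> S nS; rewrite ffunE /coef hb.
- by move=> S nS; rewrite ffunE /coef hb.
- by apply/eqP=> c0; apply: nOm; rewrite eOm c0 scale0r.
- by apply: wedge_rows_row_free => t0; apply: nOm; rewrite eOm t0 scaler0.
split; first by rewrite eb -[c *: _]eOm.
apply/eqP=> z; move: nd; rewrite -eb complex_form_imag.
move/(scaled_power_neq0 _ _ _ _ two_im_neq0); apply.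
by rewrite eOm -wedge_powE.
Qed.

(** By the Clifford relation, v.u + u.(tau v) = 0 for tau the reflection in u, and u
acts invertibly. *)
Lemma clif_reflection u v rho : pairing u u != 0 ->
  clif v (clif u rho) = 0 <-> clif (reflection u v) rho = 0.
Proof.
move=> q0; set q := pairing u u in q0 *.
have e : clif u (clif (reflection u v) rho) = - clif v (clif u rho).
  rewrite /reflection addrC -scaleNr clif_linearl.
  rewrite clifDr clifZr clif_sqr scalerA mulNr divfK //.
  rewrite scaleNr -(clif_anticommute v u) opprD addrAC.
  by rewrite -addrA subrr addr0.
split=> [z|z].
  have := clif_sqr u (clif (reflection u v) rho).
  rewrite e z oppr0 clif0r => /esym/eqP.
  by rewrite scaler_eq0 -/q (negPf q0) => /eqP.
by apply/eqP; rewrite -oppr_eq0 -e z clif0r.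
Qed.

(** If J' is conjugate to J by the reflection in r, then r.rho is its pure spinor,
whose type is given by [type_increase] or [type_decrease]. *)
Lemma has_type_reflection J J' (r : 'rV[R]_(N + N)) k :
  (0 < N)%N -> N = (2 * n)%N -> pairing r r != 0 ->
  (forall v, i_eigenspace J' v <->
     i_eigenspace J (reflection (complexify_mx r) v)) ->
  has_type n J k ->
  has_type n J' (k + 1) \/ ((0 < k)%N /\ has_type n J' (k - 1)).
Proof.
move=> N0 dimN q0 eigJ' /has_typeP [le_kn [b [Om [hb dOm [nz sg] nd]]]].
set u := complexify_mx r.
have uu0 : pairing u u != 0 by rewrite complexify_pairing fmorph_eq0.
have sg' : spinor_generator J' (clif u (ext_exp b * Om)).
  split.
    apply/eqP=> z; case/eqP: nz.
    have := clif_sqr u (ext_exp b * Om); rewrite z clif0r => /esym/eqP.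
    by rewrite scaler_eq0 (negPf uu0) => /eqP.
  move=> v; rewrite eigJ' sg; apply: iff_sym.
  exact: clif_reflection.
have eu : row_mx (lsubmx u) (rsubmx u) = u := hsubmxK u.
have XR : map_mx conjc (lsubmx u) = lsubmx u by rewrite map_lsubmx conj_complexify.
have xiR : map_mx conjc (rsubmx u) = rsubmx u by rewrite map_rsubmx conj_complexify.
have q : eval_covector (rsubmx u) (lsubmx u) = pairing u u.
  by rewrite pairing_diag.
have [iOm|niOm] := eqVneq (interior (lsubmx u) Om) 0.
  left.
  have [lt_kn d' e' nd'] := type_increase N0 dimN le_kn hb dOm XR xiR q uu0
    erefl erefl nd iOm.
  rewrite addn1; apply/has_typeP; split=> //.
  exists b, ((cov (rsubmx u) + interior (lsubmx u) b) * Om); split.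
  - exact: hb.
  - exact: d'.
  - by rewrite -e' eu.
  - exact: nd'.
right.
have [k' [b' [Om' [ek hb' d' e' nd']]]] := type_decrease N0 le_kn hb dOm
  XR xiR q uu0 erefl erefl nd (elimN eqP niOm).
rewrite ek subn1 /=; split=> //; apply/has_typeP; split.
  by rewrite ltnW // -ek.
exists b', Om'; split=> //.
by rewrite -e' eu.
Qed.

End TypeOfStructure.

(** * Reflections and the bracket *)

Section Eigenplane.
Variables (K : numFieldType) (N : nat).

(** For D skew with D E = 0, the bracket of a double extension of an abelian
quadratic algebra: E is central and D is the adjoint action of a vector dual
to E. *)
Definition metric_bracket (D : 'M[K]_(N + N)) (E u v : 'rV[K]_(N + N)) :=
  (2 * pairing u E) *: (v *m D) - (2 * pairing v E) *: (u *m D) +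
  (2 * pairing (u *m D) v) *: E.

Variables (D : 'M[K]_(N + N)) (f w : 'rV[K]_(N + N)) (lam : K).
Hypotheses (Dskew : forall u v, pairing (u *m D) v = - pairing u (v *m D)).
Hypotheses (fD : f *m D = lam *: f) (wD : w *m D = - lam *: w).
Hypotheses (ff : pairing f f = 0) (ww : pairing w w = 0) (fw : pairing f w != 0).

Lemma pairing_sub_isotropic : pairing (f - w) (f - w) = - (2 * pairing f w).
Proof. by rewrite !pairing_bilinear ff ww (pairingC w f); ring. Qed.

Lemma pairing_sub_isotropic_neq0 : pairing (f - w) (f - w) != 0.
Proof.
by rewrite pairing_sub_isotropic oppr_eq0 mulf_neq0 // pnatr_eq0.
Qed.

(** Conjugation by the reflection in f - w exchanges the eigenvalues of D on the
isotropic lines of f and w and leaves D unchanged on their orthogonal. *)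
Lemma reflection_conj u :
  reflection (f - w) (reflection (f - w) u *m D) =
  u *m D + (2 * lam / pairing f w) *: (pairing u f *: w - pairing u w *: f).
Proof.
rewrite /reflection pairing_sub_isotropic mulmxBl -scalemxAl mulmxBl fD wD.
rewrite !pairing_bilinear !Dskew fD wD !pairing_bilinear ff ww (pairingC w f).
by apply/rowP=> j; rewrite !mxE; field.
Qed.

(** By [reflection_conj] the two brackets differ by the one whose derivation sends
u to a multiple of <u,f> w - <u,w> f. Where <u,f> is mu <u,E>, its terms along w
cancel, and what is left is proportional to f - mu E. *)
Lemma metric_bracket_reflection E u v (mu : K) :
  pairing f E = 0 -> pairing w E = 0 ->
  pairing u f = mu * pairing u E -> pairing v f = mu * pairing v E ->
  exists x, reflection (f - w) (metric_bracket D E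
      (reflection (f - w) u) (reflection (f - w) v)) =
    metric_bracket D E u v + x *: (f - mu *: E).
Proof.
move=> fE wE uf vf; have q0 := pairing_sub_isotropic_neq0.
(* E is orthogonal to f - w. *)
have TE : reflection (f - w) E = E.
  rewrite /reflection !pairing_bilinear !(pairingC E) fE wE subrr mulr0 mul0r.
  by rewrite scale0r subr0.
have uE z : pairing (reflection (f - w) z) E = pairing z E.
  by rewrite -{1}TE reflection_isometry.
have lin (x y z : K) (p q r : 'rV_(N + N)) :
    reflection (f - w) (x *: p - y *: q + z *: r) =
    x *: reflection (f - w) p - y *: reflection (f - w) q +
    z *: reflection (f - w) r.
  by rewrite -!mul_reflection_mx !mulmxDl mulNmx -!scalemxAl.
have eD : pairing (reflection (f - w) u *m D) (reflection (f - w) v) =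
    pairing (reflection (f - w) (reflection (f - w) u *m D)) v.
  by rewrite -(reflection_isometry _ v q0) reflectionK.
rewrite /metric_bracket lin eD TE !uE !reflection_conj !pairing_bilinear uf vf.
exists (4 * lam / pairing f w *
  (pairing v E * pairing u w - pairing u E * pairing v w)).
rewrite (pairingC w v) (pairingC f v) vf.
by apply/rowP=> j; rewrite !mxE; ring.
Qed.

End Eigenplane.

(** * The Courant bracket of a diagonal almost abelian algebra *)

Section DiagonalBracket.
Variables (K : numFieldType) (m : nat) (a : 'rV[K]_m).
Local Notation N := (1 + m)%N.
Implicit Types (u v : 'rV[K]_(N + N)) (x y : 'rV[K]_N).

(** The eigenvalues of ad e_0 on g and, with opposite signs, on g^*. *)
Definition weight : 'rV[K]_(N + N) :=
  row_mx (row_mx 0 a) (- row_mx 0 a).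

Definition adE : 'M[K]_(N + N) := diag_mx weight.

Lemma mul_adE u j : (u *m adE) 0 j = u 0 j * weight 0 j.
Proof. by rewrite /adE mul_mx_diag mxE. Qed.

Definition dual_index (j : 'I_(N + N)) : 'I_(N + N) :=
  match split j with inl i => rshift N i | inr i => lshift N i end.

Lemma dual_lshift i : dual_index (lshift N i) = rshift N i.
Proof. by rewrite /dual_index (unsplitK (inl _)). Qed.

Lemma dual_rshift i : dual_index (rshift N i) = lshift N i.
Proof. by rewrite /dual_index (unsplitK (inr _)). Qed.

Lemma weight_dual j : weight 0 (dual_index j) = - weight 0 j.
Proof.
rewrite /weight; case: (split_ordP j) => i ->.
  by rewrite dual_lshift row_mxEl row_mxEr [LHS]mxE.
by rewrite dual_rshift row_mxEl row_mxEr [fun_of_matrix (- _) _ _]mxE opprK.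
Qed.

Lemma pairing_dual u j : pairing u (delta_mx 0 (dual_index j)) = 2^-1 * u 0 j.
Proof.
rewrite pairingE; case: (split_ordP j) => i ->.
  rewrite dual_lshift (bigD1 i) //= big1 ?addr0 => [|k nki].
    by rewrite !mxE eq_lrshift !eqxx /=; ring.
  by rewrite !mxE eq_lrshift eq_rshift (negPf nki) /=; ring.
rewrite dual_rshift (bigD1 i) //= big1 ?addr0 => [|k nki].
  by rewrite !mxE eq_rlshift !eqxx /=; ring.
by rewrite !mxE eq_rlshift eq_lshift (negPf nki) /=; ring.
Qed.

Lemma adE_skew u v : pairing (u *m adE) v = - pairing u (v *m adE).
Proof.
rewrite !pairingE -sumrN; apply: eq_bigr => i _; rewrite !mul_adE.
rewrite /weight !row_mxEl !row_mxEr [fun_of_matrix (- _) _ _]mxE; ring.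
Qed.

Definition e0dual : 'rV[K]_(N + N) := delta_mx 0 (rshift N ord0).

Lemma weight_e0dual : weight 0 (rshift N ord0) = 0.
Proof.
rewrite /weight row_mxEr [LHS]mxE.
have -> : ord0 = lshift m ord0 :> 'I_(1 + m) by apply: val_inj.
by rewrite row_mxEl mxE oppr0.
Qed.

Lemma e0dual_adE : e0dual *m adE = 0.
Proof.
apply/rowP=> j; rewrite mul_adE [RHS]mxE mxE eqxx /=.
by case: eqP => [->|_]; rewrite ?weight_e0dual ?mulr0 ?mul0r.
Qed.

Lemma pairing_e0dual u : 2 * pairing u e0dual = u 0 (lshift N ord0).
Proof.
have := pairing_dual u (lshift N ord0).
rewrite dual_lshift => ->.
by rewrite mulrA mulfV ?mul1r // pnatr_eq0.
Qed.

Lemma bracket_diag x y i : almost_abelian_bracket (diag_mx a) x y 0 i =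
  (row_mx 0 a : 'rV_N) 0 i * (x 0 0 * y 0 i - y 0 0 * x 0 i).
Proof.
rewrite /almost_abelian_bracket tr_diag_mx !mul_mx_diag.
case: (split_ordP i) => j ->; first by rewrite !row_mxEl !mxE mul0r.
by rewrite !row_mxEr !mxE; ring.
Qed.

Lemma coad_diag x xi j : coad (almost_abelian_bracket (diag_mx a)) x xi 0 j =
  - (x 0 0 * xi 0 j * (row_mx 0 a : 'rV_N) 0 j) +
  (j == 0)%:R * \sum_i xi 0 i * x 0 i * (row_mx 0 a : 'rV_N) 0 i.
Proof.
rewrite mxE /eval_covector.
under eq_bigr => i _ do rewrite bracket_diag mulrBr mulrBr !mulrA.
rewrite sumrB opprB addrC; congr (_ + _).
  rewrite (bigD1 j) //= big1 ?addr0 => [|i nij].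
    by rewrite [delta_mx _ _ _ _]mxE !eqxx /=; ring.
  by rewrite [delta_mx 0 j 0 i]mxE (negPf nij) andbF mulr0.
rewrite mulr_sumr; apply: eq_bigr => i _.
by rewrite [delta_mx 0 j 0 0]mxE eq_sym /=; ring.
Qed.

Lemma courant_diag u v :
  courant (almost_abelian_bracket (diag_mx a)) u v =
  metric_bracket adE e0dual u v.
Proof.
rewrite /metric_bracket !pairing_e0dual.
have -> : 2 * pairing (u *m adE) v =
    \sum_i (rsubmx v 0 i * lsubmx u 0 i - rsubmx u 0 i * lsubmx v 0 i) *
           (row_mx 0 a : 'rV_N) 0 i.
  rewrite pairingE mulr_sumr; apply: eq_bigr => i _.
  rewrite !mul_adE /weight row_mxEl row_mxEr [fun_of_matrix (- _) _ _]mxE.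
  by rewrite ![lsubmx _ _ _]mxE ![rsubmx _ _ _]mxE; field.
have entry (x y z : K) (A B : 'rV_(N + N)) j :
    (x *: A - y *: B + z *: e0dual) 0 j =
    x * A 0 j - y * B 0 j + z * (j == rshift N ord0)%:R.
  by rewrite !mxE eqxx eq_sym.
apply/rowP=> j; rewrite entry !mul_adE /courant /weight.
case: (split_ordP j) => i ->.
  rewrite !row_mxEl bracket_diag eq_lrshift ![lsubmx _ _ _]mxE /=; ring.
rewrite !row_mxEr [LHS]mxE [fun_of_matrix (- coad _ _ _) _ _]mxE !coad_diag.
rewrite eq_rshift ![fun_of_matrix (- _) _ _]mxE.
under [\sum_i (_ - _) * _]eq_bigr do rewrite mulrBl.
rewrite sumrB ![lsubmx _ 0 0]mxE ![rsubmx _ 0 i]mxE; ring.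
Qed.

End DiagonalBracket.

(** * The i-eigenspace of an orthogonal complex structure *)

Section RealStructure.
Variables (R : realType) (M : nat).
Local Notation C := R[i].
Local Notation cx := (@complexify_mx R _ _).
Local Notation im := (Complex 0 1 : C).
Implicit Types (u v : 'rV[C]_(M + M)) (r s : 'rV[R]_(M + M)).

Variable J : 'M[R]_(M + M).
Hypothesis JJ : J *m J = - 1%:M.
Hypothesis Jorth : forall r s, pairing (r *m J) (s *m J) = pairing r s.

Lemma mul_J_J u : u *m cx J *m cx J = - u.
Proof.
rewrite -mulmxA -complexify_mul JJ /complexify_mx map_mxN map_mx1.
by rewrite mulmxN mulmx1.
Qed.

Lemma Jskew_real r s : pairing (r *m J) s = - pairing r (s *m J).
Proof.
by rewrite -[RHS]pairingNr -(Jorth r (- _)) mulNmx -mulmxA JJ mulmxN mulmx1 opprK.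
Qed.

Lemma Jskew u v : pairing (u *m cx J) v = - pairing u (v *m cx J).
Proof.
rewrite (complexify_decomp u) (complexify_decomp v) !mulmxDl -!scalemxAl.
rewrite -!complexify_mul !pairing_bilinear !complexify_pairing !Jskew_real !rmorphN; ring.
Qed.

Lemma eigenspace_proj u : i_eigenspace J (u - im *: (u *m cx J)).
Proof.
rewrite /i_eigenspace mulmxBl -scalemxAl mul_J_J scalerBr scalerA mul_im_im.
by rewrite scalerN scaleN1r !opprK addrC.
Qed.

Lemma eigenspaceD u v x : i_eigenspace J u -> i_eigenspace J v ->
  i_eigenspace J (u + x *: v).
Proof.
rewrite /i_eigenspace => eu ev; rewrite mulmxDl -scalemxAl eu ev.
by rewrite scalerDr !scalerA mulrC.
Qed.

Lemma eigenspaceZ u x : i_eigenspace J u -> i_eigenspace J (x *: u).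
Proof. by rewrite /i_eigenspace -scalemxAl => ->; rewrite !scalerA mulrC. Qed.

Lemma oppr_scale_scale (V : lmodType C) (x y : C) (v : V) :
  - (x *: (- y *: v)) = (x * y) *: v.
Proof. by rewrite scaleNr scalerN opprK scalerA. Qed.

(** On the i-eigenspace J acts as the scalar i, and J is skew. *)
Lemma eigenspace_isotropic u s : i_eigenspace J u ->
  pairing u (cx s *m cx J) = - im * pairing u (cx s).
Proof.
move=> eu; have := Jskew u (cx s); rewrite eu pairingZl => /eqP.
by rewrite eq_sym eqr_oppLR => /eqP ->; rewrite mulNr.
Qed.

Lemma eigenspace_conj_reflection r u : pairing r r != 0 ->
  i_eigenspace (reflection_mx r *m J *m reflection_mx r) u <->
  i_eigenspace J (reflection (cx r) u).
Proof.
move=> q0; have q0' : pairing (cx r) (cx r) != 0.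
  by rewrite complexify_pairing fmorph_eq0.
rewrite /i_eigenspace !complexify_mul complexify_reflection_mx !mulmxA.
rewrite !mul_reflection_mx; split=> [e|->]; last first.
  by rewrite -!mul_reflection_mx -scalemxAl !mul_reflection_mx reflectionK.
rewrite -[LHS](reflectionK _ q0') e.
by rewrite -!mul_reflection_mx -scalemxAl.
Qed.

End RealStructure.

(** * The reflection preserving integrability *)

Section SwapEigenplane.
Variables (R : realType) (m : nat) (a : 'rV[R]_m).
Local Notation N := (1 + m)%N.
Local Notation C := R[i].
Local Notation cx := (@complexify_mx R _ _).
Local Notation im := (Complex 0 1 : C).
Local Notation D := (adE a).
Local Notation E := (@e0dual R m).
Variable J : 'M[R]_(N + N).
Local Notation brC := (almost_abelian_bracket (complexify_mx (diag_mx a))).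
Hypothesis gcsJ : generalized_complex brC J.

Let JJ : J *m J = - 1%:M. Proof. by case: gcsJ. Qed.
Let Jorth r s : pairing (r *m J) (s *m J) = pairing r s.
Proof. by case: gcsJ. Qed.

Let adE_complex : adE (cx a) = cx D.
Proof.
rewrite /adE /complexify_mx map_diag_mx; congr diag_mx.
by rewrite /weight map_row_mx map_mxN map_row_mx map_mx0.
Qed.

Let e0dual_complex : @e0dual C m = cx E.
Proof. by rewrite /complexify_mx map_delta_mx. Qed.

Let courant_complex u v : courant brC u v = metric_bracket (cx D) (cx E) u v.
Proof.
have -> : cx (diag_mx a) = diag_mx (cx a) by rewrite /complexify_mx map_diag_mx.
by rewrite courant_diag adE_complex e0dual_complex.
Qed.

Let c : R := (E *m J) 0 (rshift N ord0).
Let f : 'rV[R]_(N + N) := E *m J - c *: E.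

Let JEE : pairing (E *m J) E = 0.
Proof.
have := Jskew_real JJ Jorth E E; rewrite (pairingC E (E *m J)) => /eqP.
by rewrite -addr_eq0 -mulr2n mulrn_eq0 /= => /eqP.
Qed.

Let EE : pairing E E = 0.
Proof.
apply: (mulfI (_ : 2 != 0)); first by rewrite pnatr_eq0.
by rewrite pairing_e0dual mulr0 mxE eq_lrshift andbF.
Qed.

Let fE : pairing f E = 0.
Proof. by rewrite /f !pairing_bilinear JEE EE mulr0 subr0. Qed.

Let ff : pairing f f = 0.
Proof. by rewrite /f !pairing_bilinear Jorth (pairingC E (E *m J)) EE JEE; ring. Qed.

Let f_e0dual : f 0 (rshift N ord0) = 0.
Proof.
rewrite /f [LHS]mxE [fun_of_matrix (- _) _ _]mxE [fun_of_matrix (_ *: _) _ _]mxE.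
by rewrite [fun_of_matrix E _ _]mxE !eqxx mulr1 subrr.
Qed.

(** Otherwise J E = c E, hence c^2 = -1 with c real. *)
Let f_neq0 : f != 0.
Proof.
apply/eqP=> /eqP; rewrite subr_eq0 => /eqP EJ.
have /rowP/(_ (rshift N ord0)) : E *m J *m J = (c * c) *: E.
  by rewrite {1}EJ -scalemxAl EJ scalerA.
have : 0 <= c * c by rewrite -expr2 sqr_ge0.
move: (c * c) => x x_ge0; rewrite -mulmxA JJ mulmxN mulmx1 !mxE !eqxx mulr1.
by move=> x_lt0; rewrite -x_lt0 oppr_ge0 ler10 in x_ge0.
Qed.

Let ED : E *m D = 0 := e0dual_adE a.

(** The vectors l0 = E - i J E and v0 = e_0 - i J e_0 lie in the i-eigenspace, and
their bracket is a combination of D J E, with nonzero coefficient, and E. The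
imaginary part of its eigenvector equation writes D J E in terms of J E and E. *)
Let f_eigen : exists lam, f *m D = lam *: f.
Proof.
pose l0 := cx E - im *: (cx E *m cx J).
pose e0 : 'rV[C]_(N + N) := delta_mx 0 (lshift N ord0).
pose v0 := e0 - im *: (e0 *m cx J).
have [_ _ closed] := gcsJ.
have el0 : i_eigenspace J l0 by apply: eigenspace_proj.
have ev0 : i_eigenspace J v0 by apply: eigenspace_proj.
have l0E : pairing l0 (cx E) = 0.
  by rewrite !pairing_bilinear -complexify_mul !complexify_pairing EE JEE mulr0 subr0.
have l0D : l0 *m cx D = - im *: cx (E *m J *m D).
  rewrite mulmxBl -scalemxAl -!complexify_mul ED scaleNr.
  by rewrite /complexify_mx map_mx0 sub0r.
(* <e_0,E> = 1/2 is the real part of <v0,E>. *)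
have s0 : 2 * pairing v0 (cx E) * im != 0.
  have e0E : e0 = cx (delta_mx 0 (lshift N ord0)) by rewrite /complexify_mx map_delta_mx.
  have dE : 2 * pairing (delta_mx 0 (lshift N ord0)) E = 1.
    by rewrite pairing_e0dual mxE !eqxx.
  have x0 : pairing (delta_mx 0 (lshift N ord0)) E != 0.
    by apply/eqP=> x0; move/eqP: dE; rewrite x0 mulr0 eq_sym oner_eq0.
  rewrite /v0 !pairing_bilinear e0E -complexify_mul !complexify_pairing.
  rewrite !mulf_neq0 ?pnatr_eq0 //; last by rewrite eq_complex /= oner_eq0 andbF.
  by rewrite eq_complex /= !(mul0r, mul1r, mulr0, subr0) (negPf x0).
have {closed} [s [t [s_neq0 y]]] : exists s t, s != 0 /\
    i_eigenspace J (s *: cx (E *m J *m D) + t *: cx E).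
  exists (2 * pairing v0 (cx E) * im), (2 * pairing (l0 *m cx D) v0); split=> //.
  clearbody l0 v0; have := closed l0 v0 el0 ev0.
  rewrite courant_complex /metric_bracket l0E mulr0 scale0r sub0r {1}l0D.
  by rewrite oppr_scale_scale.
have := eigenspaceZ s^-1 y; rewrite scalerDr !scalerA mulVf // scale1r.
move: (s^-1 * t) => z; rewrite /i_eigenspace mulmxDl -scalemxAl -!complexify_mul.
move/complexify_Im; set p := complex.Re z; set q := complex.Im z => e.
exists q; rewrite /f mulmxBl -scalemxAl ED scaler0 subr0.
(* Compare the coefficients on E, where D J E has none. *)
have ep : p = q * c.
  have := congr1 (fun M : 'rV_(N + N) => M 0 (rshift N ord0)) e.
  rewrite [fun_of_matrix (_ + _) _ _]mxE mul_adE weight_e0dual mulr0 add0r.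
  rewrite [fun_of_matrix (_ *: _) _ _]mxE [fun_of_matrix (_ *: E) _ _]mxE.
  by rewrite [fun_of_matrix E _ _]mxE !eqxx mulr1 => <-.
by rewrite scalerBr e scalerA ep addrK.
Qed.

(** The partner w of f is the basis vector dual to one on which f has a nonzero
coordinate. On the i-eigenspace <f,u> = (- i - c) <E,u>, so the defect found in
[metric_bracket_reflection] is a multiple of E - i J E. *)
Lemma exists_reflection : exists r : 'rV[R]_(N + N), pairing r r != 0 /\
  generalized_complex brC (reflection_mx r *m J *m reflection_mx r).
Proof.
have [lam fD] := f_eigen.
have /rV0Pn[j fj] := f_neq0.
pose w : 'rV[R]_(N + N) := delta_mx 0 (dual_index j).
have wj : weight a 0 j = lam.
  have := congr1 (fun M : 'rV_(N + N) => M 0 j) fD.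
  by rewrite mul_adE [RHS]mxE mulrC => /(mulIf fj).
have wD : w *m D = - lam *: w.
  apply/rowP=> k; rewrite mul_adE [RHS]mxE /w mxE eqxx /=.
  by case: eqP => [->|_]; rewrite ?mul0r ?mulr0 // weight_dual wj mulrC.
have ww : pairing w w = 0.
  rewrite pairing_dual mxE; case: (split_ordP j) => i ->.
    by rewrite dual_lshift eq_lrshift andbF mulr0.
  by rewrite dual_rshift eq_rlshift andbF mulr0.
have fw : pairing f w != 0.
  by rewrite pairing_dual mulf_neq0 // invr_eq0 pnatr_eq0.
have wE : pairing w E = 0.
  apply: (mulfI (_ : 2 != 0)); first by rewrite pnatr_eq0.
  rewrite pairing_e0dual mulr0 mxE eqxx /=.
  move: fj; case: (split_ordP j) => i ->; first by rewrite dual_lshift eq_lrshift.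
  rewrite dual_rshift eq_lshift; case: (ord0 =P i) => // <-.
  by rewrite f_e0dual eqxx.
have q0 : pairing (f - w) (f - w) != 0 by apply: pairing_sub_isotropic_neq0.
exists (f - w); split=> //; have [_ _ closed] := gcsJ.
have TT : reflection_mx (f - w) *m reflection_mx (f - w) = 1%:M.
  apply/row_matrixP => i; rewrite !rowE mulmxA !mul_reflection_mx.
  by rewrite reflectionK // mulmx1.
split.
- rewrite -!mulmxA (mulmxA (reflection_mx _) (reflection_mx _)) TT mul1mx.
  by rewrite (mulmxA J) JJ mulNmx mul1mx mulmxN TT.
- move=> u v; rewrite !mulmxA !mul_reflection_mx reflection_isometry // Jorth.
  by rewrite reflection_isometry.
move=> u v /(eigenspace_conj_reflection _ _ q0) eu.
move=> /(eigenspace_conj_reflection _ _ q0) ev.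
apply/(eigenspace_conj_reflection _ _ q0); rewrite courant_complex.
have q0' : pairing (cx (f - w)) (cx (f - w)) != 0.
  by rewrite complexify_pairing fmorph_eq0.
rewrite -(reflectionK u q0') -(reflectionK v q0').
move: (reflection _ u) (reflection _ v) eu ev => {}u {}v eu ev.
have uf z : i_eigenspace J z ->
    pairing z (cx f) = (- im - c%:C%C) * pairing z (cx E).
  move=> ez; rewrite /f complexify_sub complexify_mul complexify_scale.
  by rewrite !pairing_bilinear (eigenspace_isotropic JJ Jorth) // mulrBl.
rewrite complexify_sub.
have cDskew y z : pairing (y *m cx D) z = - pairing y (z *m cx D).
  by rewrite -adE_complex adE_skew.
have cfD : cx f *m cx D = lam%:C%C *: cx f.
  by rewrite -complexify_mul fD complexify_scale.
have cwD : cx w *m cx D = - lam%:C%C *: cx w.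
  by rewrite -complexify_mul wD complexify_scale rmorphN.
have cff : pairing (cx f) (cx f) = 0 by rewrite complexify_pairing ff.
have cww : pairing (cx w) (cx w) = 0 by rewrite complexify_pairing ww.
have cfw : pairing (cx f) (cx w) != 0.
  by rewrite complexify_pairing fmorph_eq0.
have cfE : pairing (cx f) (cx E) = 0 by rewrite complexify_pairing fE.
have cwE : pairing (cx w) (cx E) = 0 by rewrite complexify_pairing wE.
have [x ->] := metric_bracket_reflection cDskew cfD cwD cff cww cfw cfE cwE
  (uf u eu) (uf v ev).
apply: eigenspaceD; first by rewrite -courant_complex; apply: closed.
have -> : cx f - (- im - c%:C%C) *: cx E = im *: (cx E - im *: (cx E *m cx J)).
  rewrite /f complexify_sub complexify_scale complexify_mul.
  move: (cx E) (cx E *m cx J) => e ej; apply/rowP=> k.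
  rewrite !mxE mulrBr mulrA mul_im_im; ring.
by apply/eigenspaceZ/eigenspace_proj.
Qed.

End SwapEigenplane.

(** * Neighbouring types *)

Theorem corollary3p4 (R : realType) (n m : nat) (A : 'M[R]_m) (k : nat)
    (dim_g : (1 + m = 2 * n)%N) (A_diag : is_diag_mx A) :
  admits_gcs_of_type n A k ->
  admits_gcs_of_type n A (k + 1) \/
  ((0 < k)%N /\ admits_gcs_of_type n A (k - 1)).
Proof.
have /diag_mxP[a eA] := A_diag.
move=> [J [gJ tJ]]; rewrite eA in gJ *.
have [r [q0 gJ']] := exists_reflection gJ.
have [t|[k0 t]] := has_type_reflection (isT : (0 < 1 + m)%N) dim_g q0
  (fun v => eigenspace_conj_reflection J v q0) tJ.
  by left; exists (reflection_mx r *m J *m reflection_mx r).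
by right; split=> //; exists (reflection_mx r *m J *m reflection_mx r).
Qed.
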